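(* Let $0<\alpha<n$, $1\le p<\frac n\alpha$, and define $q$ by $\frac1p-\frac1q=\frac\alpha n$. There is a constant $C=C(n,\alpha,p)$ such that for every weight $w\in A_{p,q}$ on $\mathbb{R}^n$, every $f\in L^p(\mathbb{R}^n)$ and every $\lambda>0$, $$\big|\{x\in\mathbb{R}^n: |w(x)I_\alpha(w^{-1}f)(x)|>\lambda\}\big|\le C\,[w]_{A_{p,q}}\,[w^q]_{A_\infty}^q\,\frac1{\lambda^q}\left(\int_{\mathbb{R}^n}|f|^p\,dx\right)^{q/p}.$$ The same inequality holds if $I_\alpha$ is replaced by the fractional maximal operator $M_\alpha$.
   Context: Cubes in $\mathbb{R}^n$ have sides parallel to the coordinate axes. A weight is a non-negative measurable function that is positive a.e. Fractional integral: $I_\alpha g(x)=\int_{\mathbb{R}^n}\frac{g(y)}{|x-y|^{n-\alpha}}\,dy$. Fractional maximal operator: $M_\alpha g(x)=\sup_{Q\ni x}|Q|^{\alpha/n}\frac1{|Q|}\int_Q|g(y)|\,dy$, supremum over all cubes containing $x$. For $1<p<\frac n\alpha$, with $\frac1p+\frac1{p'}=1$, $w\in A_{p,q}$ means $[w]_{A_{p,q}}=\sup_Q\left(\frac1{|Q|}\int_Q w^q\,dx\right)\left(\frac1{|Q|}\int_Q w^{-p'}\,dx\right)^{q/p'}<\infty$. For $p=1$, $w\in A_{1,q}$ means $[w]_{A_{1,q}}=\sup_Q\operatorname{ess\,sup}_{x\in Q} w(x)^{-q}\left(\frac1{|Q|}\int_Q w^q\,dx\right)<\infty$. $[u]_{A_\infty}=\sup_Q\frac1{\int_Q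 u\,dx}\int_Q M(u\chi_Q)\,dx$ is the Fujii–Wilson characteristic, where $Mg(x)=\sup_{Q\ni x}|Q|^{-1}\int_Q|g|$ is the Hardy–Littlewood maximal operator. *)

(* Defs.v *)
(* The space R^n is the type n.-tuple R, with R : realType.  Its Lebesgue
   measure is built in two steps: first the n-fold product measure on the Borel
   (product) sigma-algebra, then its Caratheodory completion, so that
   measurability below means Lebesgue measurability. *)
From HB Require Import structures.
From mathcomp Require Import all_boot all_order all_algebra.
From mathcomp Require Import all_classical all_reals all_analysis.
From mathcomp Require Import ess_sup_inf.
Set Implicit Arguments.
Unset Strict Implicit.
Unset Printing Implicit Defensive.
Import Order.TTheory GRing.Theory Num.Theory.
Import numFieldNormedType.Exports.
Local Open Scope classical_set_scope.
Local Open Scope ring_scope.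

Section tuple_measure.
Context {R : realType}.
Local Open Scope ereal_scope.

Definition tcons n (xt : measurableTypeR R * n.-tuple (measurableTypeR R)) :
  n.+1.-tuple (measurableTypeR R) := [tuple of xt.1 :: xt.2].

Lemma measurable_tcons n : measurable_fun [set: _] (@tcons n).
Proof. exact: measurable_cons. Qed.

Section step.
Variables (n : nat)
  (m : {sigma_finite_measure set (n.-tuple (measurableTypeR R)) -> \bar R}).

Definition tuple_measureS : set (n.+1.-tuple (measurableTypeR R)) -> \bar R :=
  pushforward (lebesgue_measure \x m) (@tcons n).

Let tuple_measureS0 : tuple_measureS set0 = 0.
Proof. by rewrite /tuple_measureS /pushforward preimage_set0 measure0. Qed.

Let tuple_measureS_ge0 A : 0 <= tuple_measureS A.
Proof. exact: (measure_ge0 (lebesgue_measure \x m)). Qed.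

Let tuple_measureS_sigma_additive : semi_sigma_additive tuple_measureS.
Proof.
move=> F mF tF mUF; rewrite /tuple_measureS /pushforward preimage_bigcup.
apply: measure_semi_sigma_additive.
- by move=> k; rewrite -[X in measurable X]setTI; exact: measurable_tcons.
- apply/trivIsetP => /= i j _ _ ij; rewrite -preimage_setI.
  by move/trivIsetP : tF => /(_ _ _ _ _ ij) ->//; rewrite preimage_set0.
- rewrite -preimage_bigcup -[X in measurable X]setTI.
  exact: measurable_tcons.
Qed.

HB.instance Definition _ := isMeasure.Build _ _ _ tuple_measureS
  tuple_measureS0 tuple_measureS_ge0 tuple_measureS_sigma_additive.

Let tuple_measureS_sigma_finite : sigma_finite setT tuple_measureS.
Proof.
have /sigma_finiteP[F [FT ndF Foo]] := sigma_finiteT (@lebesgue_measure R).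
have /sigma_finiteP[G [GT ndG Goo]] := sigma_finiteT m.
pose g (t : n.+1.-tuple (measurableTypeR R)) := (thead t, [tuple of behead t]).
have gK : cancel (@tcons n) g.
  by case=> x t; rewrite /g /tcons /= theadE; congr pair; exact: val_inj.
have mg : measurable_fun setT g.
  apply: measurable_fun_pair; first exact: measurable_tnth.
  exact: measurable_behead.
exists (fun k => g @^-1` (F k `*` G k)).
  apply/seteqP; split=> // t _.
  have [i _ Fi] : (\bigcup_k F k) (g t).1 by rewrite -FT.
  have [j _ Gj] : (\bigcup_k G k) (g t).2 by rewrite -GT.
  exists (maxn i j) => //; split => /=.
  - by move: Fi; exact/subsetPset/ndF/leq_maxl.
  - by move: Gj; exact/subsetPset/ndG/leq_maxr.
move=> k; have [mF Fk] := Foo k; have [mG Gk] := Goo k; split.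
  by rewrite -[X in measurable X]setTI; apply: mg => //; exact: measurableX.
rewrite /tuple_measureS /pushforward -comp_preimage.
have -> : g \o @tcons n = id by apply/funext => x /=; rewrite gK.
by rewrite preimage_id product_measure1E// lte_mul_pinfty// ge0_fin_numE.
Qed.

HB.instance Definition _ := Measure_isSigmaFinite.Build _ _ _ tuple_measureS
  tuple_measureS_sigma_finite.

End step.

Fixpoint borel_lebesgue n :
    {sigma_finite_measure set (n.-tuple (measurableTypeR R)) -> \bar R} :=
  if n is k.+1 then tuple_measureS (borel_lebesgue k)
  else dirac [tuple].

Definition box_of k (a : k.-tuple (measurableTypeR R)) (l : R) :
    set (k.-tuple (measurableTypeR R)) :=
  [set x | forall i, (tnth a i <= tnth x i <= tnth a i + l)%R].

Lemma measurable_box_of k (a : k.-tuple (measurableTypeR R)) (l : R) :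
  measurable (box_of a l).
Proof.
rewrite (_ : box_of a l = \bigcap_(i in [set: 'I_k])
   ((fun x : k.-tuple (measurableTypeR R) => tnth x i) @^-1`
      `[tnth a i, (tnth a i + l)%R]%classic)); last first.
  apply/seteqP; split => [x xa i _ /=|x xa i].
    by rewrite in_itv/=; exact: xa.
  by have := xa i I; rewrite /= in_itv.
apply: fin_bigcap_measurable => [|i _].
  exact: finite_finset.
by rewrite -[X in measurable X]setTI; apply: measurable_tnth => //; exact: measurable_itv.
Qed.

Lemma borel_lebesgue_box_of k (a : k.-tuple (measurableTypeR R)) (l : R) :
  (0 <= l)%R -> borel_lebesgue k (box_of a l) = (l ^+ k)%:E.
Proof.
move=> l0; elim: k a => [a|k IH a].
  rewrite /= diracE mem_set ?expr0//.
  by move=> [].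
rewrite /= /tuple_measureS /pushforward.
have ta j : tnth a (lift ord0 j) = tnth [tuple of behead a] j.
  by rewrite [in LHS](tuple_eta a) tnthS.
rewrite (_ : _ @^-1` _ = `[thead a, (thead a + l)%R]%classic `*`
    box_of [tuple of behead a] l); last first.
  apply/seteqP; split=> [[x t] /= H|[x t] /= [+ H] i].
    split; first by have := H ord0; rewrite /= in_itv/=.
    by move=> i; have := H (lift ord0 i); rewrite ta tnthS.
  rewrite in_itv/= => Hx.
  case: (unliftP ord0 i) => [j ->|->]; last by [].
  by rewrite ta tnthS; exact: H.
rewrite product_measure1E//; last exact: measurable_box_of.
rewrite IH /= lebesgue_measure_itv/= lte_fin.
rewrite -EFinD addrAC subrr add0r exprS EFinM.
case: ltP => //; rewrite gerDl => l1.
by have -> : l = 0%R by apply/eqP; rewrite eq_le l0 l1.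
Qed.

End tuple_measure.

Section lebesgue.
Context (R : realType) (n : nat).
Local Open Scope ereal_scope.

Definition Rn : Type := caratheodory_type (borel_lebesgue (R := R) n)^*%mu.
HB.instance Definition _ := Measurable.on Rn.

Definition lebesgue : set Rn -> \bar R :=
  @completed_measure_extension _ _ _ (borel_lebesgue n).
HB.instance Definition _ := Measure.on lebesgue.

Let lebesgue_sigma_finite : sigma_finite setT lebesgue.
Proof.
exact/completed_measure_extension_sigma_finite/sigma_finiteT.
Qed.
HB.instance Definition _ := Measure_isSigmaFinite.Build _ _ _ lebesgue
  lebesgue_sigma_finite.

End lebesgue.
Arguments lebesgue {R n}.

Section definitions.
Context {R : realType} {n : nat}.
Implicit Types (x y a : Rn R n) (Q : set (Rn R n)) (u w g : Rn R n -> R).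
Implicit Types (alpha p q : R).

Definition eucl_dist x y : R :=
  Num.sqrt (\sum_(i < n) (tnth x i - tnth y i) ^+ 2).

Definition cube_of a (l : R) : set (Rn R n) :=
  [set x | forall i, tnth a i <= tnth x i <= tnth a i + l].

Definition cube Q := exists a l, 0 < l /\ Q = cube_of a l.

Definition weight w :=
  [/\ measurable_fun setT w, (forall x, 0 <= w x) &
      {ae lebesgue, forall x, 0 < w x}].

Local Open Scope ereal_scope.

Lemma lebesgue_cube a (l : R) : (0 <= l)%R ->
  lebesgue (cube_of a l) = (l ^+ n)%:E.
Proof.
move=> l0; rewrite -(borel_lebesgue_box_of a l0).
rewrite /lebesgue /completed_measure_extension measurable_mu_extE//.
exact: measurable_box_of.
Qed.

Definition average Q (g : Rn R n -> \bar R) : \bar R :=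
  (lebesgue Q)^-1 * \int[lebesgue]_(y in Q) g y.

(* At y = x the kernel takes the junk value 0 instead of +oo; this does not
   affect the integral, since n > 0 wherever frac_integral is used. *)
Definition frac_integral alpha g x : \bar R :=
  \int[lebesgue]_y (g y / eucl_dist x y `^ (n%:R - alpha))%:E.

Definition frac_maximal alpha g x : \bar R :=
  ereal_sup [set lebesgue Q `^ (alpha / n%:R)
                 * average Q (fun y => `|g y|%:E)
            | Q in [set Q | cube Q /\ Q x]].

Definition HL_max g x : \bar R :=
  ereal_sup [set average Q (fun y => `|g y|%:E)
            | Q in [set Q | cube Q /\ Q x]].

(* The Hoelder conjugate p' of a real number p > 1. *)
Definition conj_exp p : R := ((1 - p^-1)^-1)%R.

(* Multiplying the non-negative function w^-q by the indicator of Q turns the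
   library's global essential supremum into the essential supremum over Q. *)
Definition A1q_char q w : \bar R :=
  ereal_sup [set ess_sup lebesgue (fun x => (w x `^ (- q) * \1_Q x)%:E)
                 * average Q (fun x => (w x `^ q)%:E)
            | Q in cube].

Definition Apq_char p q w : \bar R :=
  if p == 1%R then A1q_char q w else
  ereal_sup [set average Q (fun x => (w x `^ q)%:E)
                 * average Q (fun x => (w x `^ (- conj_exp p))%:E)
                     `^ (q / conj_exp p)
            | Q in cube].

Definition Apq p q w := Apq_char p q w < +oo.

(* Fujii-Wilson characteristic *)
Definition Ainfty_char u : \bar R :=
  ereal_sup [set (\int[lebesgue]_(x in Q) (u x)%:E)^-1
                 * \int[lebesgue]_(x in Q) HL_max (fun y => u y * \1_Q y)%R x
            | Q in cube].

End definitions.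

(* Main.v *)
(* Write u = w^q, A = [u]_{A_oo} and g = w^-1 |f|.  Pointwise M_alpha g is at
   most n^((n - alpha)/2) I_alpha g, so only I_alpha g has to be bounded.

   Quantitative A_oo: let Omega_t be the union of the maximal dyadic subcubes
   of Q on which u has average > t.  For s >= u(Q)/|Q| the function
   sum_(i < N) 2^i s 1_(Omega_(2^(i+1) s)) is at most M(u 1_P) on each maximal
   cube P of Omega_s, whence sum_(1 <= i <= N) u(Omega_(2^i s)) is at most
   2^(n+1) A u(Omega_s).  Thus the mass u(Omega_t) halves each time t is
   multiplied by 2^N, N about 2^(n+2) A, and since u(E \ Omega_t) <= t |E| this
   gives u(E) <= 3 u(Q) (|E|/|Q|)^theta for E in Q, theta = 1/(N+1).

   To bound the integral of w I_alpha g over E, cut the kernel into dyadic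
   scales.  At scale l, averaging over the cubes B of side 4l (Tonelli) reduces
   the estimate to a product of the integrals of w over E and of g over B,
   which Hoelder, the A_{p,q} condition and the decay above control by a
   constant times
     [w]^(1/q) |f|_p |E|^(1-1/p) l^(- n theta/q) min(|E|,l^n)^(alpha/n + theta/q).
   The sum over l is geometric on either side of l^n = |E|; the ratio
   2^(- n theta/q) costs 1/theta, that is one factor A.  Taking for E bounded
   pieces of the level set {w I_alpha g > lambda} gives the weak-type bound. *)

Require Import Defs.
From HB Require Import structures.
From mathcomp Require Import all_boot all_order all_algebra.
From mathcomp Require Import all_classical all_reals all_analysis.
From mathcomp Require Import measurable_realfun ess_sup_inf.
From mathcomp Require Import ring lra.
Set Implicit Arguments.
Unset Strict Implicit.
Unset Printing Implicit Defensive.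
Import Order.TTheory GRing.Theory Num.Theory.
Import numFieldNormedType.Exports.
Local Open Scope classical_set_scope.
Local Open Scope ring_scope.

(** The decay of u(E)/u(Q) is what makes the sum over scales converge. With theta = 0 the bound at
    scale l would be a multiple of min(|E|, l^n)^(alpha/n): summable over l^n <= |E|, but constant
    in l beyond. The gain theta/q supplies the missing factor l^(- n theta/q) at large scales and
    cancels at small ones. So A enters only through the large scales, and linearly; its q-th power
    comes from solving lambda |E| <= B |E|^(1 - 1/q) for |E|.

    The A_oo argument is arranged to need neither the measurability of the maximal function nor a
    differentiation theorem: [HL_max] is only bounded below, by a step function, and u(E \ Omega_t)
    <= t |E| follows from approximating E by unions of grid cells, on each of which the
    corresponding bound comes from the definition of Omega_t.

    Grid cells are half-open so that they tile the space, while the cubes of the statement are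
    closed; the two differ by null sets. *)

Lemma measurable_fun_inv_ge0 d (T : measurableType d) (R : realType)
    (f : T -> R) : measurable_fun setT f -> (forall x, 0 <= f x) ->
  measurable_fun setT (fun x => (f x)^-1).
Proof.
move=> mf f0; rewrite (_ : (fun x => _) = (fun x => f x `^ (-1))).
  exact: (measurableT_comp (measurable_powR (-1)) mf).
by apply/funext => x; rewrite powR_inv1.
Qed.

(** * Integrals of non-negative functions *)

Section integration.
Context d (T : measurableType d) (R : realType).
Variable mu : {measure set T -> \bar R}.
Local Open Scope ereal_scope.

(* No measurability is assumed: this is applied to [HL_max], whose
   measurability is never needed. *)
Lemma le_ge0_integral (D : set T) (f g : T -> \bar R) :
  (forall x, D x -> 0 <= f x) -> (forall x, D x -> f x <= g x) ->
  \int[mu]_(x in D) f x <= \int[mu]_(x in D) g x.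
Proof.
move=> f0 fg.
have g0 x : D x -> 0 <= g x by move=> Dx; exact: le_trans (f0 _ Dx) (fg _ Dx).
rewrite !ge0_integralE//; apply: le_ereal_sup => _ [h /= hf <-].
exists h => //= x; apply: le_trans (hf x) _.
by rewrite !patchE; case: ifPn => // /set_mem; exact: fg.
Qed.

Lemma le_integral_countable_bigcup (I : countType) (D : set I)
    (P : I -> set T) (U : set T) (f g : T -> \bar R) :
  U = \bigcup_(i in D) P i ->
  (forall i, D i -> measurable (P i)) -> trivIset D P ->
  measurable_fun U f -> measurable_fun U g ->
  (forall x, 0 <= f x) -> (forall x, 0 <= g x) ->
  (forall i, D i -> \int[mu]_(x in P i) f x <= \int[mu]_(x in P i) g x) ->
  \int[mu]_(x in U) f x <= \int[mu]_(x in U) g x.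
Proof.
move=> -> mP tP mf mg f0 g0 fg.
(* Reindexing by [nat] through the codes of [I]; a code that decodes to nothing, or to an index
   outside [D], contributes the empty set. *)
pose F k := if pickle_inv k is Some i then
  (if `[< D i >] then P i else set0) else set0.
have mF k : measurable (F k).
  rewrite /F; case: pickle_inv => // i; case: asboolP => // Di; exact: mP.
have FE : \bigcup_(i in D) P i = \bigcup_k F k.
  apply/seteqP; split=> [x [i Di Pi]|x [k _]].
    by exists (pickle i) => //; rewrite /F pickleK_inv asboolT.
  rewrite /F; case: pickle_inv => // i; case: asboolP => // Di Pi.
  by exists i.
have tF : trivIset setT F.
  apply/trivIsetP => i j _ _ ij; rewrite /F.
  have := pickle_invK i (T := I); have := pickle_invK j (T := I).
  case: pickle_inv => [a|]; case: pickle_inv => [b|]//=; rewrite ?(setI0,set0I)//.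
  move=> aj bi.
  case: asboolP => Da; rewrite ?set0I//; case: asboolP => Db; rewrite ?setI0//.
  move/trivIsetP : tP; apply=> //; apply: contraNN ij => /eqP ba.
  by rewrite -aj -bi ba.
rewrite FE in mf mg *.
rewrite !ge0_integral_bigcup//.
apply: lee_nneseries => [k _ _|k _]; first exact: integral_ge0.
rewrite /F; case: pickle_inv => [i|]; last by rewrite !integral_set0.
by case: asboolP => Di; [exact: fg|rewrite !integral_set0].
Qed.

(** Hölder's inequality with exponents 1/s and 1/(1 - s). With the powers placed this way s = 1 is
    included, so s = 1/p can be used for every p >= 1. *)
Lemma integral_powR_mul_le (D : set T) (a b : T -> R) (s : R) :
  measurable D -> measurable_fun setT a -> measurable_fun setT b ->
  (forall x, 0 <= a x)%R -> (forall x, 0 <= b x)%R -> (0 < s <= 1)%R ->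
  \int[mu]_(x in D) (a x `^ s * b x `^ (1 - s))%:E <=
  (\int[mu]_(x in D) (a x)%:E) `^ s * (\int[mu]_(x in D) (b x)%:E) `^ (1 - s).
Proof.
move=> mD ma mb a0 b0 /andP[s0]; rewrite le_eqVlt => /predU1P[->|s1].
  rewrite subrr poweRe0 mule1 poweRe1; last first.
    by apply: integral_ge0 => x _; rewrite lee_fin.
  rewrite le_eqVlt; apply/orP; left; apply/eqP; apply: eq_integral => x _.
  by rewrite powRr0 mulr1 powRr1.
have s1' : (0 < 1 - s)%R by rewrite subr_gt0.
have [f fE] : {f : T -> R | f = fun x => (a \_ D) x `^ s}%R by eexists.
have [g gE] : {g : T -> R | g = fun x => (b \_ D) x `^ (1 - s)}%R by eexists.
have aD0 x : (0 <= (a \_ D) x)%R by rewrite patchE; case: ifP.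
have bD0 x : (0 <= (b \_ D) x)%R by rewrite patchE; case: ifP.
have maD : measurable_fun setT (a \_ D).
  by apply/(measurable_restrictT _ _).1 => //; exact: measurable_funTS.
have mbD : measurable_fun setT (b \_ D).
  by apply/(measurable_restrictT _ _).1 => //; exact: measurable_funTS.
have mf : measurable_fun setT f by rewrite fE; exact: (measurableT_comp (measurable_powR _)).
have mg : measurable_fun setT g by rewrite gE; exact: (measurableT_comp (measurable_powR _)).
have := @hoelder _ _ _ mu f g s^-1 (1 - s)^-1 mf mg.
rewrite !invr_gt0 !invrK => /(_ s0 s1').
rewrite subrKC => /(_ erefl).
rewrite Lnorm1 unlock/= !invrK.
have E h (c : T -> R) t : (forall x, 0 <= c x)%R -> (0 < t)%R ->
    (h = fun x => (c \_ D) x `^ t)%R ->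
    \int[mu]_x (`|h x| `^ t^-1)%:E = \int[mu]_(x in D) (c x)%:E.
  move=> c0 t0 ->; rewrite [RHS]integral_mkcond; apply: eq_integral => x _.
  rewrite /= ger0_norm ?powR_ge0// !patchE.
  case: ifP => _; last by rewrite powR0 ?powR0 ?gt_eqF// invr_gt0.
  by rewrite -powRrM mulfV ?gt_eqF// powRr1.
rewrite (E f a s)// (E g b (1 - s))%R//; apply: le_trans.
rewrite [leLHS]integral_mkcond; apply: le_ge0_integral => x _.
  by rewrite patchE; case: ifP => // _; rewrite lee_fin mulr_ge0// powR_ge0.
rewrite patchE; case: ifP => xD; last by rewrite lee_fin.
by rewrite lee_fin fE gE !patchE xD ler_norm.
Qed.

End integration.

(** * Lebesgue measure and cubes *)

Section rn.
Context (R : realType) (n : nat).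
Local Notation T := (Rn R n).
Local Notation mu := (@lebesgue R n).

Lemma borel_measurable_Rn (A : set (n.-tuple (measurableTypeR R))) :
  measurable A -> measurable (A : set T).
Proof. by move=> mA; apply: sub_caratheodory; exact: sub_sigma_algebra. Qed.

Lemma measurable_coord i : measurable_fun setT (fun x : T => tnth x i : R).
Proof.
move=> _ B mB; rewrite setTI.
apply: borel_measurable_Rn; rewrite -[X in measurable X]setTI.
exact: measurable_tnth.
Qed.

Lemma measurable_cube_of (a : T) l : measurable (cube_of a l).
Proof. by apply: borel_measurable_Rn; exact: measurable_box_of. Qed.

(** [lebesgue] is given by an outer measure on all subsets, so level sets of [frac_maximal] can be
    compared without knowing them measurable. *)
Lemma le_lebesgue (A B : set T) : A `<=` B -> (mu A <= mu B)%E.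
Proof. by move=> AB; exact: (@le_mu_ext _ _ _ (borel_lebesgue n) A B AB). Qed.

(** The outer measure is an infimum over countable covers by Borel sets; [B] is the union of a
    nearly optimal cover. A Borel set is wanted because the approximation by grid cells runs through
    generators of the Borel sigma-algebra. *)
Lemma Rn_measurable_outer (E : set T) (e : R) : measurable E ->
  (mu E < +oo)%E -> 0 < e ->
  exists B : set (n.-tuple (measurableTypeR R)),
    [/\ measurable B, E `<=` (B : set T) & (mu (B : set T) <= mu E + e%:E)%E].
Proof.
move=> mE Ey e0.
have finE : mu E \is a fin_num by rewrite ge0_fin_numE.
have [_ [F [mF EF] <-] Fe] := lb_ereal_inf_adherent e0 finE.
exists (\bigcup_k F k); split => //; first exact: bigcup_measurable.
apply: le_trans (ltW Fe).
apply: le_trans (outer_measure_sigma_subadditive (mu_ext (borel_lebesgue n)) F) _.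
by apply: lee_nneseries => // k _; rewrite [leLHS]measurable_mu_extE.
Qed.

Definition half_open (b : T) (s : R) : set T :=
  [set x | forall i, tnth b i <= tnth x i < tnth b i + s].

Lemma measurable_half_open b s : measurable (half_open b s).
Proof.
rewrite (_ : half_open b s = \bigcap_(i in [set: 'I_n])
   ((fun x : T => tnth x i : R) @^-1` `[tnth b i, (tnth b i + s)[%classic)).
  apply: fin_bigcap_measurable => [|i _]; first exact: finite_finset.
  by rewrite -[X in measurable X]setTI; apply: measurable_coord.
by apply/seteqP; split => x /= + i => [+ _|/(_ i I)]; rewrite /= in_itv /=; exact.
Qed.

Lemma half_open_sub b s : half_open b s `<=` cube_of b s.
Proof. by move=> x bx i; have /andP[-> /ltW ->] := bx i. Qed.

Lemma bernoulli_ineq (t : R) k : 0 <= t <= 1 -> 1 - k%:R * t <= (1 - t) ^+ k.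
Proof.
move=> /andP[t0 t1]; elim: k => [|k IH]; first by rewrite mul0r subr0 expr0.
rewrite exprS; apply: le_trans (ler_wpM2l _ IH); last by rewrite subr_ge0.
by rewrite -natr1 -subr_ge0; have := ler0n R k; nra.
Qed.

(** The half-open cube contains closed cubes of side s(1 - t), whose measure tends to s^n as t tends
    to 0. *)
Lemma lebesgue_half_open_diff b s : 0 < s ->
  mu (cube_of b s `\` half_open b s) = 0.
Proof.
move=> s0; apply/eqP; rewrite eq_le measure_ge0 andbT.
rewrite measureD; [|exact: measurable_cube_of|exact: measurable_half_open|];
  last by rewrite /= lebesgue_cube ?ltW// ltry.
rewrite setIidr; last exact: half_open_sub.
rewrite /= (lebesgue_cube _ (ltW s0)) leeBlDr ?add0e; last first.
  rewrite ge0_fin_numE//; apply: le_lt_trans (le_lebesgue (@half_open_sub b s)) _.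
  by rewrite /= lebesgue_cube ?ltW// ltry.
apply/lee_addgt0Pr => e e0.
(* Chosen so that n t s^n <= e, which Bernoulli's inequality turns into a loss of at most e; [n.+1]
   keeps the denominator positive also for n = 0, and the minimum keeps 1 - t non-negative. *)
pose t := Num.min 1 (e / (n.+1%:R * s ^+ n)).
have sn0 : 0 < s ^+ n by exact: exprn_gt0.
have t0 : 0 < t by rewrite lt_min ltr01/= divr_gt0// mulr_gt0.
have t1 : t <= 1 by rewrite ge_min lexx.
have te : n%:R * t * s ^+ n <= e.
  apply: (@le_trans _ _ (n.+1%:R * t * s ^+ n)).
    by rewrite !ler_pM2r// ler_nat.
  by rewrite mulrAC mulrC -ler_pdivlMr ?mulr_gt0// ge_min lexx orbT.
apply: (@le_trans _ _ ((s * (1 - t)) ^+ n + e)%:E).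
  rewrite lee_fin exprMn -lerBlDr (le_trans (lerB (lexx _) te))//.
  have /(ler_wpM2l (ltW sn0)) : 1 - n%:R * t <= (1 - t) ^+ n.
    by rewrite bernoulli_ineq// ltW.
  by apply: le_trans; rewrite mulrBr mulr1 mulrC.
rewrite EFinD leeD2r// -(@lebesgue_cube _ _ b); last first.
  by rewrite mulr_ge0 ?subr_ge0// ltW.
apply: le_lebesgue => x bx i; have /andP[-> /le_lt_trans ->]// := bx i.
by rewrite ltrD2l gtr_pMr// gtrBl.
Qed.

Lemma integral_half_open b s (f : T -> \bar R) : 0 < s ->
  measurable_fun setT f -> (forall x, 0 <= f x)%E ->
  (\int[mu]_(x in half_open b s) f x = \int[mu]_(x in cube_of b s) f x)%E.
Proof.
move=> s0 mf f0; symmetry.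
rewrite (ge0_negligible_integral _ _ _ _ (lebesgue_half_open_diff b s0))//.
- by rewrite setDD setIidr//; exact: half_open_sub.
- by apply: measurableD; [exact: measurable_cube_of|exact: measurable_half_open].
- exact: measurable_cube_of.
- exact: measurable_funTS.
Qed.

Lemma lebesgue_half_open b s : 0 < s -> mu (half_open b s) = (s ^+ n)%:E.
Proof.
move=> s0; rewrite -(@lebesgue_cube _ _ b) ?ltW//.
have := @integral_half_open b s (cst 1%E) s0.
rewrite !integral_cst ?mul1e//; first by apply.
- exact: measurable_cube_of.
- exact: measurable_half_open.
Qed.

Lemma averageE b s (f : T -> \bar R) : 0 < s ->
  average (cube_of b s) f = (((s ^+ n)^-1)%:E * \int[mu]_(x in cube_of b s) f x)%E.
Proof.
by move=> s0; rewrite /average lebesgue_cube ?ltW// inver gt_eqF// exprn_gt0.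
Qed.

End rn.

(** * Approximation by unions of dyadic cells *)

Section density.
Context d (T : measurableType d) (R : realType).
Variable mu : {measure set T -> \bar R}.
Local Open Scope ereal_scope.

Lemma density_measure (f : T -> \bar R) :
  measurable_fun setT f -> (forall x, 0 <= f x) ->
  exists nu : {measure set T -> \bar R}, forall B, nu B = \int[mu]_(x in B) f x.
Proof.
move=> mf f0; pose nu B := \int[mu]_(x in B) f x.
have nu0 : nu set0 = 0 by rewrite /nu integral_set0.
have nu_ge0 B : 0 <= nu B by exact: integral_ge0.
have nu_sigma : semi_sigma_additive nu.
  move=> F mF tF mUF; rewrite /nu ge0_integral_bigcup//; last exact: measurable_funTS.
  by apply: is_cvg_nneseries => n _ _; exact: nu_ge0.
pose M := isMeasure.Build d T R nu nu0 nu_ge0 nu_sigma.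
pose nuM : {measure set T -> \bar R} := HB.pack nu M.
by exists nuM.
Qed.

End density.

Section approximation.
Context d (T : measurableType d) (R : realType).
Variable mu : {measure set T -> \bar R}.
Variable A : set (set T).
Hypothesis muT : (mu setT < +oo)%E.
Hypothesis mA : A `<=` measurable.
Hypothesis A0 : A set0.
Hypothesis AC : forall B, A B -> A (~` B).
Hypothesis AU : forall B C, A B -> A C -> A (B `|` C).
Local Open Scope ereal_scope.

Definition approximable : set (set T) :=
  [set B | measurable B /\
    forall e : R, (0 < e)%R -> exists2 C, A C & mu (B `+` C) < e%:E].

Let muU2 B C : measurable B -> measurable C -> mu (B `|` C) <= mu B + mu C.
Proof. by move=> mB mC; exact: measureU2. Qed.

Lemma sub_approximable : A `<=` approximable.
Proof.
move=> B AB; split; first exact: mA.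
by move=> e e0; exists B => //; rewrite /setY setDv setU0 measure0 lte_fin.
Qed.

Lemma approximableC B : approximable B -> approximable (~` B).
Proof.
move=> [mB aB]; split; first exact: measurableC.
move=> e /aB [C AC' BC]; exists (~` C); first exact: AC.
by rewrite /setY !setDE !setCK setUC setIC [X in _ `|` X]setIC -!setDE.
Qed.

Lemma approximableU B C : approximable B -> approximable C ->
  approximable (B `|` C).
Proof.
move=> [mB aB] [mC aC]; split; first exact: measurableU.
move=> e e0; have e20 : (0 < e / 2)%R by rewrite divr_gt0.
have [B' AB' BB'] := aB _ e20; have [C' AC' CC'] := aC _ e20.
exists (B' `|` C'); first exact: AU.
have mY D E : measurable D -> A E -> measurable (D `+` E).
  by move=> mD /mA mE; apply: measurableU; exact: measurableD.
rewrite [e]splitr EFinD; apply: le_lt_trans (lteD BB' CC').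
apply: le_trans (muU2 (mY _ _ mB AB') (mY _ _ mC AC')).
apply: le_measure; rewrite ?inE.
- by apply: mY; [exact: measurableU|exact: AU].
- by apply: (measurableU _ _ (mY _ _ mB AB') (mY _ _ mC AC')).
- by move=> x /= [|]; tauto.
Qed.

(** Since [mu] is finite, continuity from below lets a finite partial union miss less than e/2, and
    that partial union is approximable within e/2. *)
Lemma approximable_bigcup (F : (set T)^nat) :
  (forall i, approximable (F i)) -> approximable (\bigcup_i F i).
Proof.
move=> aF; have mF i : measurable (F i) by exact: (aF i).1.
split; first exact: bigcup_measurable.
move=> e e0; have e20 : (0 < e / 2)%R by rewrite divr_gt0.
pose U n := \big[setU/set0]_(i < n.+1) F i.
have aU n : approximable (U n).
  rewrite /U; elim/big_ind : _ => //; last exact: approximableU.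
  by apply: sub_approximable; exact: A0.
have UE : \bigcup_n U n = \bigcup_i F i by exact: bigcup_bigsetU_bigcup.
have mUF : measurable (\bigcup_n U n) by rewrite UE; exact: bigcup_measurable.
have ndU : nondecreasing_seq U by move=> i j ij; apply/subsetPset; exact: subset_bigsetU.
have cU := @nondecreasing_cvg_mu _ _ _ mu _ (fun n => (aU n).1) mUF ndU.
have finU : mu (\bigcup_n U n) \is a fin_num.
  by rewrite ge0_fin_numE// (le_lt_trans _ muT)// le_measure ?inE.
have [n Un] : exists n, mu (\bigcup_n U n) - (e / 2)%:E < mu (U n).
  have supE : mu (\bigcup_n U n) = ereal_sup (range (mu \o U)).
    transitivity (limn (mu \o U)); first exact/esym/cvg_lim.
    apply/cvg_lim => //; apply: ereal_nondecreasing_cvgn => i j ij.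
    by apply: le_measure; rewrite ?inE; [exact: (aU i).1|exact: (aU j).1|
      exact/subsetPset/ndU].
  rewrite supE in finU *.
  by have [_ [n _ <-] ?] := ub_ereal_sup_adherent e20 finU; exists n.
have [C AC' UC] := (aU n).2 _ e20.
exists C => //; rewrite -UE.
have mC : measurable C by exact: mA.
have UnU : U n `<=` \bigcup_n U n by exact: bigcup_sup.
have mD : mu (\bigcup_n U n `\` U n) < (e / 2)%:E.
  rewrite measureD//; [|exact: (aU n).1|by rewrite -ge0_fin_numE].
  rewrite setIidr// lteBlDr//; last first.
    by rewrite ge0_fin_numE// (le_lt_trans _ muT)// le_measure ?inE//; exact: (aU n).1.
  by rewrite addeC -lteBlDr.
rewrite [e]splitr EFinD; apply: le_lt_trans (lteD mD UC).
have mY : measurable (U n `+` C).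
  by apply: measurableU; apply: measurableD => //; exact: (aU n).1.
have mDU : measurable (\bigcup_n U n `\` U n) by apply: measurableD => //; exact: (aU n).1.
apply: le_trans (muU2 mDU mY).
apply: le_measure; rewrite ?inE; last 1 first.
- move=> x /= [[Ux Cx]|[Cx nUx]].
    by have [Unx|Unx] := pselect (U n x); [right; left|left].
  by right; right; split => // /UnU.
- by apply: measurableU; apply: measurableD.
- exact: measurableU.
Qed.

End approximation.

(** Nesting of dyadic intervals: floor x is the integer part of half of floor (2x). *)
Lemma floor_double (R : realType) (x y : R) :
  Num.floor (2 * x) = Num.floor (2 * y) -> Num.floor x = Num.floor y.
Proof.
move=> xy; apply/eqP; rewrite floor_eq.
have /andP[m1 m2] := floor_itv y; set m := Num.floor y in m1 m2 *.
have : (m * 2 <= Num.floor (2 * x))%R by rewrite xy floor_ge_int intrM; lra.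
have : (Num.floor (2 * x) < (m + 1) * 2)%R.
  by rewrite xy floor_lt_int intrM; lra.
by rewrite floor_lt_int floor_ge_int !intrM; lra.
Qed.

Section grid.
Context (R : realType) (n : nat) (a : Rn R n) (l : R).
Hypothesis l0 : 0 < l.
Local Notation T := (Rn R n).
Local Notation mu := (@lebesgue R n).

(* The grid is anchored at the corner [a], so that the cell of level 0 and index 0
   is the half-open version of [cube_of a l]. *)
Definition gside k : R := l / 2 ^+ k.

Lemma gside0 : gside 0 = l.
Proof. by rewrite /gside expr0 divr1. Qed.

Lemma gside_gt0 k : 0 < gside k.
Proof. by rewrite divr_gt0// exprn_gt0. Qed.

Lemma gsideS k : gside k = 2 * gside k.+1.
Proof. by rewrite /gside exprS invfM mulrCA (mulrA 2) mulfV// mul1r. Qed.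

Definition gidx k (x : T) : {ffun 'I_n -> int} :=
  [ffun i => Num.floor ((tnth x i - tnth a i) / gside k)].

Definition gcorner k (z : {ffun 'I_n -> int}) : T :=
  [tuple tnth a i + (z i)%:~R * gside k | i < n].

Definition gcell k z := [set x | gidx k x = z].

Lemma gcellE k z : gcell k z = half_open (gcorner k z) (gside k).
Proof.
have H (x : T) i : (Num.floor ((tnth x i - tnth a i) / gside k) == z i) =
    (tnth (gcorner k z) i <= tnth x i < tnth (gcorner k z) i + gside k).
  rewrite floor_eq ler_pdivlMr ?gside_gt0// ltr_pdivrMr ?gside_gt0//.
  by rewrite tnth_mktuple intrD mulrDl mul1r -addrA lerBrDl ltrBlDl.
apply/seteqP; split=> x.
  by move=> /= xz i; rewrite -H -xz ffunE.
by move=> xz; apply/ffunP => i; rewrite ffunE; apply/eqP; rewrite H.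
Qed.

Lemma gcell_corner k z : gcell k z (gcorner k z).
Proof. by rewrite gcellE => i; rewrite lexx ltrDl gside_gt0. Qed.

Lemma measurable_gcell k z : measurable (gcell k z).
Proof. rewrite gcellE; exact: measurable_half_open. Qed.

Lemma lebesgue_gcell k z : mu (gcell k z) = (gside k ^+ n)%:E.
Proof. by rewrite gcellE lebesgue_half_open// gside_gt0. Qed.

Lemma integral_gcell k z (f : T -> \bar R) :
  measurable_fun setT f -> (forall x, 0 <= f x)%E ->
  (\int[mu]_(x in gcell k z) f x =
   \int[mu]_(x in cube_of (gcorner k z) (gside k)) f x)%E.
Proof. by move=> mf f0; rewrite gcellE integral_half_open// gside_gt0. Qed.

Lemma gidx_le j k x y : (j <= k)%N -> gidx k x = gidx k y -> gidx j x = gidx j y.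
Proof.
move=> jk; rewrite -(subnKC jk); elim: (k - j)%N => [|m IH]; first by rewrite addn0.
move=> xy; apply: IH; apply/ffunP => i; move/ffunP/(_ i) : xy.
rewrite !ffunE addnS => xy; apply: floor_double.
have E (z : T) : 2 * ((tnth z i - tnth a i) / gside (j + m)) =
           (tnth z i - tnth a i) / gside (j + m).+1.
  by rewrite (gsideS (j + m)); field; rewrite gt_eqF// gside_gt0.
by rewrite !E.
Qed.

Lemma gside_small (e : R) : 0 < e -> exists k, gside k <= e.
Proof.
move=> e0; exists (Num.truncn (l / e)).+1.
rewrite ler_pdivrMr ?exprn_gt0// mulrC -ler_pdivrMr// ltW//.
apply: lt_le_trans (truncnS_gt _) _.
by rewrite -natrX ler_nat ltnW// ltn_expl.
Qed.

(** Unions of cells of level [k], encoded as invariance under having the same index; in this form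
    refinement, unions and complements are immediate. *)
Definition level_set k (A : set T) := forall x y, gidx k x = gidx k y -> A x -> A y.

Lemma level_set_le j k A : (j <= k)%N -> level_set j A -> level_set k A.
Proof. by move=> jk Aj x y xy; apply: Aj; exact: gidx_le xy. Qed.

Lemma level_setE k A : level_set k A ->
  A = \bigcup_(z in [set z | gcell k z `<=` A]) gcell k z.
Proof.
move=> kA; apply/seteqP; split=> [x Ax|x [z zA /zA//]].
by exists (gidx k x) => //= y xy; exact: kA Ax.
Qed.

Lemma measurable_level_set k A : level_set k A -> measurable A.
Proof.
move=> /level_setE ->; rewrite bigcup_mkcond.
apply: countable_bigcupT_measurable => // z.
by case: ifP => // _; exact: measurable_gcell.
Qed.

Lemma trivIset_gcell k D : trivIset D (gcell k).
Proof. by move=> i j _ _ [x [<- <-]]. Qed.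

Definition grid_sets : set (set T) := [set A | exists k, level_set k A].

Lemma grid_setsU A B : grid_sets A -> grid_sets B -> grid_sets (A `|` B).
Proof.
move=> [j jA] [k kB]; exists (maxn j k) => x y xy [Ax|Bx]; [left|right].
  exact: (level_set_le (leq_maxl j k) jA) Ax.
exact: (level_set_le (leq_maxr j k) kB) Bx.
Qed.

Lemma grid_setsC A : grid_sets A -> grid_sets (~` A).
Proof.
move=> [k kA]; exists k => x y xy nAx Ay; apply: nAx.
exact: kA (esym xy) Ay.
Qed.

(** The approximable sets form a sigma-algebra, so it is enough to treat the preimages of half-lines
    under the coordinates, which generate the Borel sets. *)
Lemma grid_approximable (nu : {measure set T -> \bar R})
    (B : set (n.-tuple (measurableTypeR R))) :
  (nu setT < +oo)%E -> measurable B -> approximable nu grid_sets (B : set T).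
Proof.
move=> nuT mB.
have mg : grid_sets `<=` measurable by move=> A [k /measurable_level_set].
have g0 : grid_sets set0 by exists 0%N.
pose apx := approximable nu grid_sets.
have apx0 : apx set0 by exact: sub_approximable.
have apxC A : apx A -> apx (~` A) by apply: approximableC => //; exact: grid_setsC.
have apxU (F : (set T)^nat) : (forall i, apx (F i)) -> apx (\bigcup_i F i).
  by apply: approximable_bigcup => //; exact: grid_setsU.
suff : measurable `<=` (apx : set (set (n.-tuple (measurableTypeR R)))) by apply.
apply: smallest_sub.
  by split => // A; rewrite setTD; exact: apxC.
elim/big_ind : _ => [|C D CA DA E [/CA|/DA]//|i _]; first by [].
move=> _ [C mC <-]; rewrite setTI.
suff : measurable `<=` [set C : set R | apx ((fun x : T => tnth x i : R) @^-1` C)].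
  exact.
rewrite [X in X `<=` _](RGenInftyO.measurableE R); apply: smallest_sub.
  split => [|D|F aF] /=; first by rewrite preimage_set0.
    by rewrite setTD preimage_setC; exact: apxC.
  by rewrite preimage_bigcup; exact: apxU.
move=> _ [c ->] /=.
(* The open half-space is exhausted by the cells that end at or before c: a point with x_i < c lies
   in such a cell as soon as the side is at most c - x_i. *)
rewrite (_ : _ @^-1` _ = \bigcup_k [set x : T |
    tnth a i + (gidx k x i + 1)%:~R * gside k <= c]).
  apply: apxU => k; apply: sub_approximable => //; exists k => x y /= /ffunP xy.
  by rewrite xy.
apply/seteqP; split=> [x|x [k _]]; rewrite /= in_itv /=.
  rewrite -subr_gt0 => /gside_small[k kc]; exists k => //=.
  rewrite ffunE intrD mulrDl mul1r.
  have := floor_le ((tnth x i - tnth a i) / gside k).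
  by rewrite ler_pdivlMr ?gside_gt0//; lra.
apply: lt_le_trans; rewrite ffunE.
have := floorD1_gt ((tnth x i - tnth a i) / gside k).
by rewrite ltr_pdivrMr ?gside_gt0//; lra.
Qed.

End grid.

(** * Stopping cubes and quantitative A_infinity decay *)

Section stopping.
Context (R : realType) (n : nat) (a : Rn R n) (l : R).
Hypothesis l0 : 0 < l.
Local Notation T := (Rn R n).
Local Notation mu := (@lebesgue R n).
Local Notation gside := (gside l).
Local Notation gidx := (gidx a l).
Local Notation gcell := (gcell a l).
Local Notation gcorner := (gcorner a l).
Variable u : T -> R.
Hypothesis mu_u : measurable_fun setT u.
Hypothesis u0 : forall x, 0 <= u x.
Local Open Scope ereal_scope.

Let Q0 : set T := gcell 0 [ffun=> 0%R].

Lemma root_cell : Q0 = half_open a l.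
Proof.
rewrite /Q0 gcellE//; congr half_open; last by rewrite gside0.
by apply: eq_from_tnth => i; rewrite tnth_mktuple ffunE mul0r addr0.
Qed.

Lemma measurable_root : measurable Q0.
Proof. exact: measurable_gcell. Qed.

Lemma lebesgue_root : mu Q0 = (l ^+ n)%:E.
Proof. by rewrite lebesgue_gcell// gside0. Qed.

Lemma sub_root k x : Q0 x -> gcell k (gidx k x) `<=` Q0.
Proof. by move=> Qx y yx; apply: etrans Qx; exact: gidx_le yx. Qed.

Let mU D : measurable_fun D (EFin \o u).
Proof. by apply: measurable_funTS; exact/measurable_EFinP. Qed.

Hypothesis uQ : \int[mu]_(x in Q0) (u x)%:E < +oo.

Definition heavy (t : R) k z :=
  (t * gside k ^+ n)%:E < \int[mu]_(x in gcell k z) (u x)%:E.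

(** The set Omega_t, written as a level set of the dyadic maximal function relative to [Q0]: the
    cells of level k >= 0 around a point of [Q0] are subcells of [Q0]. *)
Definition stop_set t : set T :=
  [set x | Q0 x /\ exists k, heavy t k (gidx k x)].

(* The maximal dyadic subcells of [Q0] on which the average of [u] exceeds [t]. *)
Definition stop_cell t : set (nat * {ffun 'I_n -> int}) :=
  [set kz | [/\ gcell kz.1 kz.2 `<=` Q0, heavy t kz.1 kz.2 &
    forall j x, (j < kz.1)%N -> gcell kz.1 kz.2 x -> ~ heavy t j (gidx j x)]].

Lemma stop_setE t :
  stop_set t = \bigcup_(kz in stop_cell t) gcell kz.1 kz.2.
Proof.
apply/seteqP; split=> [x [Qx xt]|x [[k z] /= [PQ Ph Pj] Px]].
  have xt' : exists k, `[< heavy t k (gidx k x) >].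
    by case: xt => k ?; exists k; exact/asboolP.
  exists (ex_minn xt', gidx (ex_minn xt') x) => //=.
  case: ex_minnP => k /asboolP hk kmin; split => /=; first exact: sub_root.
    exact: hk.
  move=> j y jk yx /asboolP; rewrite (gidx_le l0 (ltnW jk) yx) => /kmin.
  by rewrite leqNgt jk.
by split; [exact: PQ|exists k; rewrite Px].
Qed.

Lemma trivIset_stop_cell t : trivIset (stop_cell t) (fun kz => gcell kz.1 kz.2).
Proof.
move=> [k z] [k' z'] /= [_ /= h kmin] [_ /= h' kmin'] [x /= [xz xz']].
rewrite -xz in h kmin *; rewrite -xz' in h' kmin' *.
have [kk'|kk'|->//] := ltngtP k k'.
  by case: (kmin' _ x kk').
by case: (kmin _ x kk').
Qed.

Lemma measurable_stop_set t : measurable (stop_set t).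
Proof.
rewrite stop_setE bigcup_mkcond; apply: countable_bigcupT_measurable => // kz.
by case: ifP => // _; exact: measurable_gcell.
Qed.

Lemma stop_set_sub t : stop_set t `<=` Q0.
Proof. by move=> x []. Qed.

Lemma le_heavy s t k z : (s <= t)%R -> heavy t k z -> heavy s k z.
Proof.
move=> st; apply: le_lt_trans; rewrite lee_fin ler_wpM2r//.
by rewrite exprn_ge0// ltW// gside_gt0.
Qed.

Lemma le_stop_set s t : (s <= t)%R -> stop_set t `<=` stop_set s.
Proof. by move=> st x [Qx [k xk]]; split => //; exists k; exact: le_heavy xk. Qed.

Lemma le_integral_stop_set t (f g : T -> \bar R) :
  measurable_fun setT f -> measurable_fun setT g ->
  (forall x, 0 <= f x) -> (forall x, 0 <= g x) ->
  (forall kz, stop_cell t kz -> \int[mu]_(x in gcell kz.1 kz.2) f x <=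
                                \int[mu]_(x in gcell kz.1 kz.2) g x) ->
  \int[mu]_(x in stop_set t) f x <= \int[mu]_(x in stop_set t) g x.
Proof.
move=> mf mg f0 g0 fg.
apply: (le_integral_countable_bigcup (stop_setE t)) => //.
- by move=> kz _; exact: measurable_gcell.
- exact: trivIset_stop_cell.
- exact: measurable_funTS.
- exact: measurable_funTS.
Qed.

(** By maximality the parent cell is not heavy, and its measure is 2^n times that of the cell. The
    root has no parent; the bound on the average over [Q0] keeps it from being a stopping cell. *)
Lemma stop_cell_le t kz : \int[mu]_(x in Q0) (u x)%:E <= (t * l ^+ n)%:E ->
  stop_cell t kz ->
  \int[mu]_(x in gcell kz.1 kz.2) (u x)%:E <=
  (2 ^+ n * t)%:E * mu (gcell kz.1 kz.2).
Proof.
move=> tQ; case: kz => -[|k] z /= [/= PQ hP minP].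
  have zE : z = [ffun=> 0%R].
    by rewrite -(gcell_corner a l0 0 z); apply: PQ; exact: gcell_corner.
  by move: hP; rewrite /heavy zE gside0 ltNge tQ.
have xz := gcell_corner a l0 k.+1 z; move: (gcorner k.+1 z) xz => x xz.
have := minP k x (ltnSn k) xz; rewrite /heavy => /negP; rewrite -leNgt => H.
rewrite lebesgue_gcell// -EFinM mulrAC -exprMn mulrC.
rewrite -gsideS; apply: le_trans H.
apply: ge0_subset_integral => //; [exact: measurable_gcell..| |].
  by move=> y _; rewrite lee_fin.
by move=> y /= yz; apply: (gidx_le l0 (leqnSn k)); rewrite yz -xz.
Qed.

(** Each coefficient is half the height of its set, so the terms up to the largest height reached at
    a point add up to at most that height. *)
Definition stop_sum s N x : R :=
  (\sum_(i < N) 2 ^+ i * s * \1_(stop_set (2 ^+ i.+1 * s)) x)%R.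

Lemma stop_sum_ub s N x : (0 <= s)%R -> (stop_sum s N x <= 2 ^+ N * s)%R.
Proof.
move=> s0; elim: N => [|N IH]; first by rewrite /stop_sum big_ord0 expr0 mul1r.
rewrite /stop_sum big_ord_recr/= [leRHS](_ : _ = 2 ^+ N * s + 2 ^+ N * s)%R; last by rewrite exprS; ring.
rewrite lerD//.
by rewrite ler_piMr// mulr_ge0// exprn_ge0.
Qed.

(* The weights are geometric, so only the largest height reached at [x] counts. *)
Lemma stop_sum_le s N x : (0 <= s)%R -> stop_sum s N x = 0%R \/
  exists t, [/\ (s <= t)%R, stop_set t x & (stop_sum s N x <= t)%R].
Proof.
move=> s0; elim: N => [|N IH]; first by left; rewrite /stop_sum big_ord0.
have E : stop_sum s N.+1 x =
    (stop_sum s N x + 2 ^+ N * s * \1_(stop_set (2 ^+ N.+1 * s)) x)%R.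
  by rewrite /stop_sum big_ord_recr.
rewrite E; have [xN|xN] := pselect (stop_set (2 ^+ N.+1 * s) x); last first.
  by rewrite indicE memNset// mulr0 addr0.
right; exists (2 ^+ N.+1 * s)%R; split => //.
  by rewrite ler_peMl// exprn_ege1// ler1n.
rewrite indicE mem_set// mulr1 exprS -mulrA mulr_natl mulr2n lerD2r.
exact: stop_sum_ub.
Qed.

Lemma le_HL_max (g : T -> R) b r x : (0 < r)%R -> cube_of b r x ->
  average (cube_of b r) (fun y => `|g y|%:E) <= HL_max g x.
Proof.
move=> r0 bx; apply: ereal_sup_ubound; exists (cube_of b r) => //.
by split => //; exists b, r.
Qed.

(** If the sum is non-zero at x, some subcell around x has average above a height t >= s that
    dominates the sum. It lies inside the stopping cell, where truncating u to [P] changes nothing,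
    so it competes in the supremum. *)
Lemma stop_sum_HL_max s N kz x : (0 <= s)%R -> stop_cell s kz ->
  gcell kz.1 kz.2 x ->
  (stop_sum s N x)%:E <= HL_max
    (fun y => u y * \1_(cube_of (gcorner kz.1 kz.2) (gside kz.1)) y)%R x.
Proof.
move=> s0; case: kz => k z /= [/= PQ hP minP] Px.
set P := cube_of _ _.
have PP : gcell k z `<=` P by rewrite gcellE//; exact: half_open_sub.
have [->|[t [st [Qx [j hj]] xt]]] := stop_sum_le N x s0.
  have /(le_trans _) := @le_HL_max (fun y => u y * \1_P y)%R
    (gcorner k z) (gside k) x (gside_gt0 l0 k) (PP _ Px); apply.
  rewrite /average mule_ge0//; last by apply: integral_ge0 => y _; rewrite lee_fin.
  by rewrite inve_ge0.
(* A cell that is heavy at height t is heavy at height s, and no proper ancestor of a stopping cell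
   is. *)
have kj : (k <= j)%N.
  by rewrite leqNgt; apply/negP => /minP /(_ Px); apply; exact: le_heavy hj.
pose C := cube_of (gcorner j (gidx j x)) (gside j).
have CC : gcell j (gidx j x) `<=` C by rewrite gcellE//; exact: half_open_sub.
have /(le_trans _) := @le_HL_max (fun y => u y * \1_P y)%R
    (gcorner j (gidx j x)) (gside j) x (gside_gt0 l0 j) (CC _ erefl); apply.
apply: (@le_trans _ _ t%:E); first by rewrite lee_fin.
have s0' : (0 < gside j ^+ n)%R by rewrite exprn_gt0// gside_gt0.
rewrite averageE ?gside_gt0// lee_pdivlMl// -EFinM.
apply: le_trans (ltW (_ : _ < _)) _; first by rewrite mulrC; exact: hj.
have mg : measurable_fun setT (fun y => `|u y * \1_P y|%:E).
  have mP : measurable_fun setT (\1_P : T -> R).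
    by apply: measurable_indic; exact: measurable_cube_of.
  have mg0 := measurable_funM mu_u mP.
  have mg1 := measurableT_comp (@normr_measurable R setT) mg0.
  exact/measurable_EFinP/mg1.
have <- := integral_gcell a l0 j (gidx j x) mg (fun y => normr_ge0 _).
rewrite le_eqVlt; apply/orP; left; apply/eqP; apply: eq_integral => y /set_mem yx.
rewrite indicE mem_set ?mulr1 ?ger0_norm//.
by apply: PP; rewrite -Px; exact: gidx_le yx.
Qed.

Variable A : R.
Hypothesis A0 : (0 <= A)%R.
Hypothesis uA : Ainfty_char u <= A%:E.

(** This is the Fujii-Wilson condition on the closed cube [P]. Heaviness gives u(P) > 0 and [uQ]
    gives u(P) < +oo, so the inverse in the characteristic can be cleared. *)
Lemma integral_stop_sum_cell s N kz : (0 <= s)%R -> stop_cell s kz ->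
  \int[mu]_(x in gcell kz.1 kz.2) (stop_sum s N x)%:E <=
  A%:E * \int[mu]_(x in gcell kz.1 kz.2) (u x)%:E.
Proof.
move=> s0 skz.
set P := cube_of (gcorner kz.1 kz.2) (gside kz.1).
have PP : gcell kz.1 kz.2 `<=` P by rewrite gcellE//; exact: half_open_sub.
have h0 x : (0 <= stop_sum s N x)%R.
  by apply: sumr_ge0 => i _; rewrite mulr_ge0// mulr_ge0// exprn_ge0.
have uP : \int[mu]_(x in gcell kz.1 kz.2) (u x)%:E = \int[mu]_(x in P) (u x)%:E.
  by apply: integral_gcell => //; exact/measurable_EFinP.
have uPy : \int[mu]_(x in P) (u x)%:E < +oo.
  rewrite -uP; apply: le_lt_trans uQ; apply: ge0_subset_integral => //.
  - exact: measurable_gcell.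
  - exact: measurable_root.
  - by move=> x _; rewrite lee_fin.
  - by have [] := skz.
have uP0 : 0 < \int[mu]_(x in P) (u x)%:E.
  rewrite -uP; have [_ + _] := skz; apply: le_lt_trans.
  by rewrite lee_fin mulr_ge0// exprn_ge0// ltW// gside_gt0.
set g := (fun y => u y * \1_P y)%R.
apply: (@le_trans _ _ (\int[mu]_(x in P) HL_max g x)).
  rewrite integral_mkcond [leRHS]integral_mkcond; apply: le_ge0_integral => x _.
    by rewrite patchE; case: ifP => // _; rewrite lee_fin.
  rewrite !patchE; case: ifPn => [/set_mem xP|_].
    by rewrite mem_set; [exact: stop_sum_HL_max|exact: PP].
  case: ifPn => // /set_mem xP.
  apply: le_trans (@le_HL_max g _ _ _ (gside_gt0 l0 kz.1) xP).
  rewrite averageE ?gside_gt0// mule_ge0//; last by apply: integral_ge0 => y _; rewrite lee_fin.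
  by rewrite lee_fin invr_ge0 exprn_ge0// ltW// gside_gt0.
rewrite uP.
have : (\int[mu]_(x in P) (u x)%:E)^-1 * \int[mu]_(x in P) HL_max g x <= A%:E.
  apply: le_trans uA; apply: ereal_sup_ubound; exists P => //.
  by exists (gcorner kz.1 kz.2), (gside kz.1); rewrite gside_gt0.
have finP : \int[mu]_(x in P) (u x)%:E \is a fin_num.
  by rewrite ge0_fin_numE// ltW.
rewrite -(fineK finP) in uP0 *; rewrite lte_fin in uP0.
by rewrite inver gt_eqF// lee_pdivrMl// muleC.
Qed.

Lemma integral_stop_sum s N : (0 <= s)%R ->
  \sum_(i < N) (2 ^+ i * s)%:E * mu (stop_set (2 ^+ i.+1 * s)) <=
  A%:E * \int[mu]_(x in stop_set s) (u x)%:E.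
Proof.
move=> s0.
have mI t : measurable_fun setT (\1_(stop_set t) : T -> R).
  by apply: measurable_indic; exact: measurable_stop_set.
have mZ c t : measurable_fun setT (fun x : T => (c * \1_(stop_set t) x)%R : R).
  exact: measurable_funM.
have E : \sum_(i < N) (2 ^+ i * s)%:E * mu (stop_set (2 ^+ i.+1 * s)) =
    \int[mu]_(x in stop_set s) (stop_sum s N x)%:E.
  pose f (i : 'I_N) (x : T) : \bar R :=
    (2 ^+ i * s)%:E * (\1_(stop_set (2 ^+ i.+1 * s)) x)%:E.
  have mf i : measurable_fun (stop_set s) (f i).
    by apply: measurable_funTS; exact/measurable_EFinP/mZ.
  have f0 i x : stop_set s x -> 0 <= f i x.
    by move=> _; rewrite mule_ge0// lee_fin// mulr_ge0// exprn_ge0.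
  transitivity (\int[mu]_(x in stop_set s) \sum_(i < N) f i x); last first.
    by apply: eq_integral => x _; rewrite /stop_sum -sumEFin.
  rewrite (ge0_integral_sum _ (measurable_stop_set s) mf f0).
  apply: eq_bigr => i _; rewrite /f ge0_integralZl_EFin.
  - rewrite integral_indic; [|exact: measurable_stop_set..].
    by rewrite setIidl//; apply: le_stop_set; rewrite ler_peMl// exprn_ege1// ler1n.
  - exact: measurable_stop_set.
  - by move=> x _; rewrite lee_fin.
  - by apply: measurable_funTS; exact/measurable_EFinP.
  - by rewrite mulr_ge0// exprn_ge0.
have msum : measurable_fun setT (stop_sum s N).
  by apply: measurable_sum => i; exact: mZ.
rewrite E -ge0_integralZl_EFin//; last 2 first.
- exact: measurable_stop_set.
- by move=> x _; rewrite lee_fin.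
apply: le_integral_stop_set.
- exact/measurable_EFinP.
- by apply: emeasurable_funM => //; exact/measurable_EFinP.
- by move=> x; rewrite lee_fin sumr_ge0// => i _; rewrite !mulr_ge0// exprn_ge0.
- by move=> x; rewrite mule_ge0// lee_fin.
move=> kz skz; rewrite ge0_integralZl_EFin//; last 2 first.
- exact: measurable_gcell.
- by move=> x _; rewrite lee_fin.
exact: integral_stop_sum_cell.
Qed.

Definition stop_mass t : R := fine (\int[mu]_(x in stop_set t) (u x)%:E).

Lemma stop_mass_le s t : (s <= t)%R ->
  \int[mu]_(x in stop_set t) (u x)%:E <= \int[mu]_(x in stop_set s) (u x)%:E.
Proof.
move=> st; apply: ge0_subset_integral => //; [exact: measurable_stop_set..| |].
  by move=> x _; rewrite lee_fin.
exact: le_stop_set.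
Qed.

Lemma stop_mass_root t :
  \int[mu]_(x in stop_set t) (u x)%:E <= \int[mu]_(x in Q0) (u x)%:E.
Proof.
apply: ge0_subset_integral => //; [exact: measurable_stop_set|exact: measurable_root|..].
  by move=> x _; rewrite lee_fin.
exact: stop_set_sub.
Qed.

Lemma stop_massE t : \int[mu]_(x in stop_set t) (u x)%:E = (stop_mass t)%:E.
Proof.
rewrite /stop_mass fineK// ge0_fin_numE; first exact: le_lt_trans (stop_mass_root t) uQ.
by apply: integral_ge0 => x _; rewrite lee_fin.
Qed.

(** By monotonicity u(Omega_(2^N s)) is at most each of the N masses u(Omega_(2^i s)), 1 <= i <= N,
    whose sum is at most 2^(n+1) A u(Omega_s); the lower bound on N makes this at most N/2 times
    u(Omega_s). *)
Lemma stop_mass_halve s N : (0 <= s)%R ->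
  \int[mu]_(x in Q0) (u x)%:E <= (s * l ^+ n)%:E ->
  (0 < N)%N -> (2 ^+ n.+2 * A <= N%:R)%R ->
  (2 * stop_mass (2 ^+ N * s) <= stop_mass s)%R.
Proof.
move=> s0 sQ N0 NA.
pose m t : R := fine (mu (stop_set t)).
have mE t : mu (stop_set t) = (m t)%:E.
  rewrite /m fineK// ge0_fin_numE//; apply: le_lt_trans (le_lebesgue (@stop_set_sub t)) _.
  by rewrite lebesgue_root ltry.
have vm t : (s <= t)%R -> (stop_mass t <= 2 ^+ n * t * m t)%R.
  move=> st; have t0 : (0 <= t)%R by exact: le_trans st.
  rewrite -lee_fin -stop_massE EFinM -mE -[leRHS]integral_cst; last first.
    exact: measurable_stop_set.
  apply: le_integral_stop_set => //.
     by move=> x; rewrite lee_fin mulr_ge0// exprn_ge0.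
  move=> kz skz; rewrite integral_cst; last exact: measurable_gcell.
  apply: stop_cell_le skz; apply: le_trans sQ _.
  by rewrite lee_fin ler_wpM2r// exprn_ge0// ltW.
have := integral_stop_sum N s0.
under eq_bigr do rewrite mE -EFinM.
rewrite sumEFin stop_massE lee_fin => H.
have v0 : (0 <= stop_mass s)%R.
  by rewrite -lee_fin -stop_massE; apply: integral_ge0 => x _; rewrite lee_fin.
have {}H : (N%:R * stop_mass (2 ^+ N * s) <= N%:R * (stop_mass s / 2))%R.
  apply: (@le_trans _ _ (2 ^+ n.+1 * A * stop_mass s)%R); last first.
    by move: NA; rewrite exprS => NA; have := ler_wpM2r v0 NA; lra.
  rewrite -mulrA; apply: le_trans (ler_wpM2l _ H); last by rewrite exprn_ge0.
  rewrite mulr_sumr [leLHS]mulr_natl -[X in (_ *+ X <= _)%R](card_ord N) -sumr_const.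
  apply: ler_sum => i _.
  apply: (@le_trans _ _ (stop_mass (2 ^+ i.+1 * s))).
    rewrite -lee_fin -!stop_massE; apply: stop_mass_le.
    by rewrite ler_wpM2r// ler_weXn2l// ler1n.
  apply: le_trans (vm _ _) _; first by rewrite ler_peMl// exprn_ege1// ler1n.
  by rewrite !exprS le_eqVlt; apply/orP; left; apply/eqP; ring.
by move: H; rewrite ler_pM2l ?ltr0n//; lra.
Qed.

Lemma stop_mass_iter s N j : (0 <= s)%R ->
  \int[mu]_(x in Q0) (u x)%:E <= (s * l ^+ n)%:E ->
  (0 < N)%N -> (2 ^+ n.+2 * A <= N%:R)%R ->
  (stop_mass (2 ^+ (j * N) * s) <= 2^-1 ^+ j * fine (\int[mu]_(x in Q0) (u x)%:E))%R.
Proof.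
move=> s0 sQ N0 NA; elim: j => [|j IH].
  rewrite expr0 mul1r; apply: fine_le.
  - by rewrite stop_massE.
  - by rewrite ge0_fin_numE//; apply: integral_ge0 => x _; rewrite lee_fin.
  - exact: stop_mass_root.
have js0 : (0 <= 2 ^+ (j * N) * s)%R by rewrite mulr_ge0// exprn_ge0.
have jsQ : \int[mu]_(x in Q0) (u x)%:E <= (2 ^+ (j * N) * s * l ^+ n)%:E.
  apply: le_trans sQ _; rewrite lee_fin; apply: ler_wpM2r; first by rewrite exprn_ge0// ltW.
  by rewrite ler_peMl// exprn_ege1// ler1n.
have := stop_mass_halve js0 jsQ N0 NA.
rewrite mulrA -exprD -mulSn exprS -mulrA; move: IH; lra.
Qed.

End stopping.

(** * Mass of the weight off a stopping set *)

Section differentiation.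
Context (R : realType) (n : nat) (a : Rn R n) (l : R).
Hypothesis l0 : 0 < l.
Local Notation T := (Rn R n).
Local Notation mu := (@lebesgue R n).
Local Notation gside := (gside l).
Local Notation gidx := (gidx a l).
Local Notation gcell := (gcell a l).
Variable u : T -> R.
Hypothesis mu_u : measurable_fun setT u.
Hypothesis u0 : forall x, 0 <= u x.
Local Open Scope ereal_scope.
Local Notation Q0 := (gcell 0 [ffun=> 0%R]).
Hypothesis uQ : \int[mu]_(x in Q0) (u x)%:E < +oo.

Let mQ0 : measurable Q0. Proof. exact: measurable_root. Qed.

Let mI (D : set T) (f : T -> R) : measurable D -> measurable_fun setT f ->
  measurable_fun setT (fun x => (f x * \1_D x)%:E).
Proof.
move=> mD mf; have mD' : measurable_fun setT (\1_D : T -> R) by exact: measurable_indic.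
exact/measurable_EFinP/(measurable_funM mf mD').
Qed.

Let integralI (C D : set T) (f : T -> R) :
  \int[mu]_(x in C) (f x * \1_D x)%:E = \int[mu]_(x in C `&` D) (f x)%:E.
Proof.
rewrite integral_mkcondr; apply: eq_integral => x _.
by rewrite patchE indicE; case: (x \in D); rewrite ?mulr1 ?mulr0.
Qed.

(** A cell that meets [Q0] off the stopping set contains a point none of whose cells is heavy; the
    cell itself is one of them. A cell that misses this set contributes 0 on the left. *)
Lemma off_stop_cell t k z : (0 <= t)%R ->
  \int[mu]_(x in gcell k z) (u x * \1_(Q0 `\` stop_set a l u t) x)%:E <=
  \int[mu]_(x in gcell k z) (t * \1_Q0 x)%:E.
Proof.
move=> t0; set F := Q0 `\` _.
have mF : measurable F by apply: measurableD => //; exact: measurable_stop_set.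
rewrite !integralI.
have [[x [xz [Qx nx]]]|/nonemptyPn ->] := pselect ((gcell k z `&` F) !=set0); last first.
  rewrite integral_set0; apply: integral_ge0 => x _; by rewrite lee_fin.
have zQ : gcell k z `<=` Q0 by rewrite -xz; exact: sub_root.
rewrite (setIidl zQ).
apply: (@le_trans _ _ (\int[mu]_(x in gcell k z) (u x)%:E)).
  apply: ge0_subset_integral.
  - by apply: measurableI => //; exact: measurable_gcell.
  - exact: measurable_gcell.
  - by apply: measurable_funTS; exact/measurable_EFinP.
  - by move=> y _; rewrite lee_fin.
  - exact: subIsetl.
rewrite integral_cst; last exact: measurable_gcell.
rewrite /= lebesgue_gcell// -EFinM leNgt; apply/negP => h.
by apply: nx; split => //; exists k; rewrite xz.
Qed.

(* Approximating [E] by unions of dyadic cells replaces Lebesgue's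
   differentiation theorem. *)
Lemma integral_off_stop_set t (E : set T) : (0 <= t)%R -> measurable E ->
  E `<=` Q0 `\` stop_set a l u t ->
  \int[mu]_(x in E) (u x)%:E <= t%:E * mu E.
Proof.
move=> t0 mE; set F := Q0 `\` _ => EF.
have mF : measurable F by apply: measurableD => //; exact: measurable_stop_set.
pose uF x := (u x * \1_F x)%:E.
have muF : measurable_fun setT uF by exact: mI.
have uF0 x : 0 <= uF x by rewrite lee_fin mulr_ge0.
(* The density 1 + u makes a set of small [nu]-measure small inside [Q0] both for Lebesgue measure
   and for u dx. *)
pose h x := ((1 + u x) * \1_Q0 x)%:E.
have mh : measurable_fun setT h by exact: (mI mQ0 (measurable_funD (@measurable_cst _ _ _ _ setT (1%R : R)) mu_u)).
have h0 x : 0 <= h x by rewrite lee_fin mulr_ge0// addr_ge0.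
have [nu nuE] := density_measure mu mh h0.
have nuT : nu setT < +oo.
  rewrite nuE /h integralI setTI; under eq_integral do rewrite EFinD.
  rewrite ge0_integralD; first last.
  - by apply: measurable_funTS; exact/measurable_EFinP.
  - by move=> x _; rewrite lee_fin.
  - exact: measurable_cst.
  - by move=> x _; rewrite lee_fin.
  - exact: mQ0.
  rewrite integral_cst; last exact: mQ0.
  by rewrite mul1e /= lebesgue_root// lte_add_pinfty// ltry.
have Ey : mu E < +oo.
  apply: (@le_lt_trans _ _ (mu Q0)); last by rewrite lebesgue_root ?ltry.
  by apply: le_lebesgue => x /EF[].
have finE : mu E \is a fin_num by rewrite ge0_fin_numE.
(* Three errors: [B] exceeds [E] in measure by at most e, C \ B adds at most e of Lebesgue measure
   inside [Q0], and B \ C carries at most e of the mass of u off the stopping set. *)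
have key (e : R) : (0 < e)%R ->
    \int[mu]_(x in E) (u x)%:E <= t%:E * (mu E + e%:E + e%:E) + e%:E.
  move=> e0; have [B [mB EB Be]] := Rn_measurable_outer mE Ey e0.
  have [_ /(_ e e0)[C [k kC] BC]] := grid_approximable a l0 nuT mB.
  have mC : measurable C by exact: measurable_level_set kC.
  have mB' : measurable (B : set T) by exact: borel_measurable_Rn.
  have mBC : measurable ((B : set T) `\` C) by exact: measurableD.
  have mCB : measurable (C `\` (B : set T)) by exact: measurableD.
  have nu_le (D : set T) : measurable D -> D `<=` (B : set T) `+` C -> nu D <= e%:E.
    move=> mD DBC; apply: le_trans (ltW BC); apply: le_measure; rewrite ?inE//.
    exact: measurableU.
  have -> : \int[mu]_(x in E) (u x)%:E = \int[mu]_(x in E) uF x.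
    by rewrite /uF integralI setIidl.
  apply: (@le_trans _ _ (\int[mu]_(x in C `|` ((B : set T) `\` C)) uF x)).
    apply: ge0_subset_integral => //; first exact: measurableU.
      exact: measurable_funTS.
    by move=> x /EB Bx; have [Cx|nCx] := pselect (C x); [left|right].
  rewrite ge0_integral_setU//; last 2 first.
  - exact: measurable_funTS.
  - by apply/disj_set2P; rewrite setDE setICA setICr setI0.
  apply: leeD; last first.
    apply: le_trans (nu_le _ mBC (@subsetUl _ _ _)); rewrite nuE.
    apply: le_ge0_integral => // x _; rewrite lee_fin.
    rewrite !indicE; have [/set_mem[Qx _]|xF] := boolP (x \in F).
      by rewrite (mem_set Qx) ler_wpM2r// lerDr.
    by rewrite mulr0 mulr_ge0// addr_ge0.
  apply: (@le_trans _ _ (\int[mu]_(x in C) (t * \1_Q0 x)%:E)).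
    apply: (le_integral_countable_bigcup (level_setE kC)).
    - by move=> z _; exact: measurable_gcell.
    - exact: trivIset_gcell.
    - exact: measurable_funTS.
    - by apply: measurable_funTS; exact: mI.
    - exact: uF0.
    - by move=> x; rewrite lee_fin mulr_ge0.
    - by move=> z _; exact: off_stop_cell.
  rewrite integralI integral_cst; last exact: measurableI.
  apply: lee_wpmul2l; first by rewrite lee_fin.
  apply: (@le_trans _ _ (mu ((B : set T) `|` ((C `\` (B : set T)) `&` Q0)))).
    apply: le_lebesgue => x [Cx Qx].
    by have [Bx|nBx] := pselect ((B : set T) x); [left|right].
  have mCBQ : measurable ((C `\` (B : set T)) `&` Q0) by exact: measurableI.
  apply: le_trans (measureU2 _ mB' mCBQ) _.
  apply: leeD => //; apply: le_trans (nu_le _ mCB (@subsetUr _ _ _)); rewrite nuE.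
  rewrite -[leLHS]mul1e -integral_cst// -integralI.
  apply: le_ge0_integral => x _; first by rewrite lee_fin mulr_ge0.
  by rewrite lee_fin ler_wpM2r// lerDl.
apply/lee_addgt0Pr => e e0.
(* The errors add up to (2t + 1) times the tolerance, so the tolerance is taken as e/(2t + 1). *)
have t1 : (0 < t * 2 + 1)%R by rewrite ltr_wpDl// mulr_ge0.
have := key (e / (t * 2 + 1))%R (divr_gt0 e0 t1).
rewrite -(fineK finE) -!EFinD.
move=> /le_trans; apply; rewrite lee_fin le_eqVlt; apply/orP; left; apply/eqP.
by field; rewrite gt_eqF.
Qed.

End differentiation.

Lemma two_powers (R : realType) (y : R) : 0 < y <= 1 ->
  exists j, y <= 2^-1 ^+ j /\ 2^-1 ^+ j <= 2 * y.
Proof.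
move=> /andP[y0 y1].
have ex : exists m, 2^-1 ^+ m < y.
  exists (Num.truncn y^-1).+1; rewrite exprVn -[ltRHS]invrK ltf_pV2 ?posrE ?invr_gt0 ?exprn_gt0//.
  apply: lt_trans (truncnS_gt _) _.
  by rewrite -natrX ltr_nat ltn_expl.
case: (ex_minnP ex) => -[|m] my mmin; first by move: my; rewrite expr0 ltNge y1.
exists m; split; last by move: my; rewrite exprS; lra.
by rewrite leNgt; apply/negP => /mmin; rewrite ltnn.
Qed.

(** The exponent 1/(N+1) balances two parts. At height t = 2^(jN) u(Q)/|Q| the stopping set has mass
    at most 2^-j u(Q), and the rest of E at most t |E| = (2^j y)^N y u(Q) when |E|/|Q| = y^(N+1).
    With y <= 2^-j <= 2y these are at most 2y u(Q) and y u(Q), whence the 3. *)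
Lemma Ainfty_decay (R : realType) (n : nat) (a : Rn R n) (l : R)
    (u : Rn R n -> R) (A : R) (N : nat) (E : set (Rn R n)) :
  0 < l -> measurable_fun setT u -> (forall x, 0 <= u x) ->
  0 <= A -> (Ainfty_char u <= A%:E)%E -> (0 < N)%N -> 2 ^+ n.+2 * A <= N%:R ->
  measurable E -> E `<=` cube_of a l ->
  (\int[lebesgue]_(x in cube_of a l) (u x)%:E < +oo)%E ->
  (\int[lebesgue]_(x in E) (u x)%:E <=
   (3 * (fine (lebesgue E) / l ^+ n) `^ (N.+1%:R^-1))%:E *
   \int[lebesgue]_(x in cube_of a l) (u x)%:E)%E.
Proof.
move=> l0 mu_u u0 A0 uA N0 NA mE EQ uQ.
pose mu := @lebesgue R n.
pose Q0 := gcell a l 0 [ffun=> 0].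
have mU D : measurable_fun D (EFin \o u).
  by apply: measurable_funTS; exact/measurable_EFinP.
have u0' (D : set (Rn R n)) x : D x -> (0 <= (u x)%:E)%E by rewrite lee_fin.
have mQ0 : measurable Q0 by exact: measurable_gcell.
have ln0 : 0 < l ^+ n by rewrite exprn_gt0.
have uQ0 : (\int[mu]_(x in Q0) (u x)%:E = \int[mu]_(x in cube_of a l) (u x)%:E)%E.
  by rewrite /Q0 root_cell// integral_half_open//; exact/measurable_EFinP.
have Ey : (mu E <= (l ^+ n)%:E)%E.
  by rewrite -(lebesgue_cube a (ltW l0)); exact: le_lebesgue.
have finE : mu E \is a fin_num by rewrite ge0_fin_numE// (le_lt_trans Ey) ?ltry.
pose r := fine (mu E); have rE : mu E = r%:E by rewrite /r fineK.
have r0 : 0 <= r by rewrite fine_ge0.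
rewrite -/mu -/r; set y := (r / l ^+ n) `^ _.
(* A null [E] is set aside because then y = 0, which is comparable to no power of 1/2. *)
have [r00|rn0] := eqVneq r 0.
  rewrite (ge0_negligible_integral mE mE (mU E) (u0' E)); last exact: etrans rE (congr1 EFin r00).
  rewrite setDv integral_set0 mule_ge0//; last by apply: integral_ge0 => x _; rewrite lee_fin.
  by rewrite lee_fin mulr_ge0// powR_ge0.
have yr : y ^+ N.+1 = r / l ^+ n.
  by rewrite -powR_mulrn ?powR_ge0// -powRrM mulVf// powRr1// divr_ge0// ltW.
have y01 : 0 < y <= 1.
  have rl0 : 0 < r / l ^+ n by rewrite divr_gt0// lt_neqAle eq_sym rn0.
  rewrite powR_gt0//=; have -> : 1 = 1 `^ (N.+1%:R^-1) :> R by rewrite powR1.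
  apply: ge0_ler_powR; rewrite ?nnegrE ?invr_ge0 ?(ltW rl0)//.
  by rewrite ler_pdivrMr// mul1r -lee_fin -rE.
(* With 2^-j comparable to y, both the mass of the stopping set at height
   2^(jN) u(Q)/|Q| and that of the rest of E are O(y u(Q)). *)
have [j [yj jy]] := two_powers y01.
have finQ : (\int[mu]_(x in Q0) (u x)%:E)%E \is a fin_num.
  by rewrite ge0_fin_numE ?uQ0//; apply: integral_ge0 => x _; rewrite lee_fin.
rewrite -uQ0; pose U := fine (\int[mu]_(x in Q0) (u x)%:E)%E.
have UE : (\int[mu]_(x in Q0) (u x)%:E = U%:E)%E by rewrite /U fineK.
have U0 : 0 <= U by rewrite fine_ge0//; apply: integral_ge0 => x _; rewrite lee_fin.
pose s := U / l ^+ n; have s0 : 0 <= s by rewrite divr_ge0// ltW.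
have sQ : (\int[mu]_(x in Q0) (u x)%:E <= (s * l ^+ n)%:E)%E.
  by rewrite UE /s divfK// gt_eqF.
have uQy : (\int[mu]_(x in Q0) (u x)%:E < +oo)%E by rewrite UE ltry.
have vj := stop_mass_iter l0 mu_u u0 uQy A0 uA j s0 sQ N0 NA.
set t := 2 ^+ (j * N) * s in vj.
have t0 : 0 <= t by rewrite mulr_ge0// exprn_ge0.
pose W := stop_set a l u t.
have mW : measurable W by exact: measurable_stop_set.
pose E0 := E `&` Q0.
have mE0 : measurable E0 by exact: measurableI.
have EE0 : (\int[mu]_(x in E) (u x)%:E = \int[mu]_(x in E0) (u x)%:E)%E.
  have mZ : measurable (cube_of a l `\` half_open a l).
    by apply: measurableD; [exact: measurable_cube_of|exact: measurable_half_open].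
  rewrite (ge0_negligible_integral mZ mE (mU E) (u0' E) (lebesgue_half_open_diff a l0)).
  congr (integral _ _ _); rewrite /E0 /Q0 root_cell//; apply/seteqP; split=> x [Ex].
    by move=> /= nZ; split => //; apply: contrapT => nx; apply: nZ; split => //; exact: EQ.
  by move=> hx; split => // -[].
have E0W : E0 = (E0 `&` W) `|` (E0 `\` W) by rewrite setUIDK.
rewrite EE0 E0W ge0_integral_setU//; last 4 first.
- exact: measurableI.
- exact: measurableD.
- by move=> x _; rewrite lee_fin.
- by apply/disj_set2P; apply/seteqP; split => // x [[_ Wx] [_ nWx]].
apply: (@le_trans _ _ ((2^-1 ^+ j * U)%:E + (t * r)%:E)%E).
  apply: leeD.
    apply: (@le_trans _ _ (\int[mu]_(x in W) (u x)%:E)%E).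
      apply: ge0_subset_integral; [exact: measurableI|exact: mW|exact: mU|exact: u0'|].
      exact: subIsetr.
    by rewrite /W stop_massE// lee_fin.
  apply: le_trans (integral_off_stop_set l0 mu_u u0 uQy t0 (measurableD mE0 mW) _) _.
    by move=> x [[_ Qx] nWx].
  rewrite EFinM -rE; apply: lee_wpmul2l; first by rewrite lee_fin.
  by apply: le_lebesgue => x [[]].
rewrite UE -EFinD -EFinM lee_fin.
have -> : t * r = (2 ^+ j * y) ^+ N * y * U.
  by rewrite exprMn -exprM -[_ * y]mulrA -exprSr yr /t /s; field; rewrite gt_eqF.
have H : (2 ^+ j * y) ^+ N <= 1.
  rewrite exprn_ile1//; first by rewrite mulr_ge0 ?exprn_ge0// powR_ge0.
  by move: yj; rewrite exprVn -ler_pdivlMl ?exprn_gt0// mulr1.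
have yU : 0 <= y * U by rewrite mulr_ge0// powR_ge0.
have := ler_wpM2r yU H; have := ler_wpM2r U0 jy; rewrite mul1r mulrA; lra.
Qed.

(** * The A_{p,q} condition on a single cube *)

Section positivity.
Context d (T : measurableType d) (R : realType).
Variable mu : {measure set T -> \bar R}.
Local Open Scope ereal_scope.

Lemma ae_set0 (D : set T) : measurable D -> {ae mu, forall x, ~ D x} -> mu D = 0.
Proof.
move=> mD [N [mN muN DN]]; apply: (subset_measure0 mD mN _ muN).
by move=> x Dx; apply: DN => /= nD; exact: nD.
Qed.

Lemma integral_ae_gt0 (D : set T) (h : T -> R) : measurable D -> 0 < mu D ->
  measurable_fun setT h -> (forall x, 0 <= h x)%R ->
  {ae mu, forall x, (0 < h x)%R} -> 0 < \int[mu]_(x in D) (h x)%:E.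
Proof.
move=> mD D0 mh h0 hae.
rewrite lt0e integral_ge0 ?andbT; last by move=> x _; rewrite lee_fin.
apply/eqP => H; move: D0; rewrite lt0e => /andP[/eqP + _]; apply.
apply: ae_set0 => //.
have mhD : measurable_fun D (EFin \o h).
  by apply: measurable_funTS; exact/measurable_EFinP.
have : ae_eq mu D (EFin \o h) (cst 0).
  apply/(ae_eq_integral_abs mu mD mhD); rewrite -[RHS]H.
  by apply: eq_integral => x _ /=; rewrite ger0_norm.
move: hae; apply: filterS2 => x hx + Dx => /(_ Dx) /= [] h0x.
by move: hx; rewrite h0x ltxx.
Qed.

End positivity.

Section apq.
Context (R : realType) (n : nat).
Local Notation T := (Rn R n).
Local Notation mu := (@lebesgue R n).
Variables (p q : R) (w : T -> R).
Hypothesis p1 : 1 <= p.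
Hypothesis q0 : 0 < q.
Hypothesis wW : weight w.
Local Open Scope ereal_scope.

Let mw : measurable_fun setT w. Proof. by have [] := wW. Qed.
Let w0 x : (0 <= w x)%R. Proof. by have [] := wW. Qed.

Let mpow r : measurable_fun setT (fun x => w x `^ r)%R.
Proof. exact: (measurableT_comp (measurable_powR r) mw). Qed.

Let wpow_gt0 r : {ae mu, forall x, (0 < w x `^ r)%R}.
Proof. by have [_ _] := wW; apply: filterS => x /powR_gt0; exact. Qed.

Lemma weight_cube_gt0 r a l : (0 < l)%R ->
  0 < \int[mu]_(x in cube_of a l) (w x `^ r)%:E.
Proof.
move=> l0; apply: integral_ae_gt0 => //; first exact: measurable_cube_of.
  by rewrite /= lebesgue_cube ?ltW// lte_fin exprn_gt0.
by move=> x; exact: powR_ge0.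
Qed.

Lemma average_weight_gt0 r a l : (0 < l)%R ->
  0 < average (cube_of a l) (fun x => (w x `^ r)%:E).
Proof.
move=> l0; rewrite averageE// mule_gt0 ?weight_cube_gt0//.
by rewrite lte_fin invr_gt0 exprn_gt0.
Qed.

Lemma integral_averageE (f : T -> \bar R) a l : (0 < l)%R ->
  \int[mu]_(x in cube_of a l) f x = (l ^+ n)%:E * average (cube_of a l) f.
Proof.
move=> l0; rewrite averageE// muleA -EFinM mulfV ?mul1e// gt_eqF//.
exact: exprn_gt0.
Qed.

Lemma ess_sup_weight_gt0 a l : (0 < l)%R ->
  0 < ess_sup mu (fun x => (w x `^ (- q) * \1_(cube_of a l) x)%:E).
Proof.
move=> l0; rewrite ltNge; apply/negP => /ess_supP H.
have : mu (cube_of a l) = 0.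
  apply: ae_set0; first exact: measurable_cube_of.
  move: H (wpow_gt0 (- q)); apply: filterS2 => x.
  rewrite lee_fin indicE => + wx; case: (boolP (x \in _)) => [_|xQ _].
    by rewrite mulr1 leNgt wx.
  by move: xQ; rewrite notin_setE.
rewrite /= lebesgue_cube ?ltW// => -[] /eqP; apply/negP.
by rewrite gt_eqF// exprn_gt0.
Qed.

Hypothesis wA : Apq p q w.

Lemma Apq_char_gt0 : 0 < Apq_char p q w.
Proof.
have z0 : cube (cube_of (point : T) 1%R) by exists point, 1%R.
rewrite /Apq_char; case: eqVneq => p_1.
  apply: (@lt_le_trans _ _ _ _ _ (_ : mule _ _ > 0)); last first.
    by apply: ereal_sup_ubound; exists (cube_of (point : T) 1%R).
  by rewrite mule_gt0 ?ess_sup_weight_gt0 ?average_weight_gt0.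
apply: (@lt_le_trans _ _ _ _ _ (_ : mule _ _ > 0)); last first.
  by apply: ereal_sup_ubound; exists (cube_of (point : T) 1%R).
by rewrite mule_gt0 ?poweR_gt0 ?average_weight_gt0.
Qed.

(** The other factor in the characteristic is positive, so an infinite average of w^q would make the
    characteristic infinite. *)
Lemma weight_cube_lty a l : (0 < l)%R ->
  \int[mu]_(x in cube_of a l) (w x `^ q)%:E < +oo.
Proof.
move=> l0; rewrite integral_averageE// lte_mul_pinfty// ?lee_fin ?exprn_ge0 ?ltW//.
rewrite ltNge leye_eq; apply/negP => /eqP avgy.
have Qc : cube (cube_of a l) by exists a, l.
have : Apq_char p q w = +oo; last by move: wA; rewrite /Apq => /[swap] ->.
apply/eqP; rewrite -leye_eq /Apq_char; case: eqVneq => p_1.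
  apply: (@le_trans _ _ (mule _ _)); last first.
    by apply: ereal_sup_ubound; exists (cube_of a l).
  by rewrite avgy gt0_muley// ess_sup_weight_gt0.
apply: (@le_trans _ _ (mule _ _)); last first.
  by apply: ereal_sup_ubound; exists (cube_of a l).
by rewrite avgy gt0_mulye// poweR_gt0// average_weight_gt0.
Qed.

Let minv : measurable_fun setT (fun x => (w x)^-1)%R.
Proof. exact: measurable_fun_inv_ge0. Qed.

(** The substitute for Hölder's inequality at p = 1: w^-1 = (w^-q)^(1/q) <= S^(1/q) almost
    everywhere on [D]. *)
Lemma integral_inv_weight_ess (D : set T) (f : T -> R) (S : R) :
  measurable D -> measurable_fun setT f -> (forall x, 0 <= f x)%R ->
  {ae mu, forall x, D x -> (w x `^ (- q) <= S)%R} ->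
  \int[mu]_(x in D) ((w x)^-1 * f x)%:E <=
  (S `^ q^-1)%:E * \int[mu]_(x in D) (f x)%:E.
Proof.
move=> mD mf f0 wS.
have mfD : measurable_fun D (EFin \o f).
  by apply: measurable_funTS; exact/measurable_EFinP.
have mwf : measurable_fun D (fun x => ((w x)^-1 * f x)%:E).
  apply: measurable_funTS; apply/measurable_EFinP; exact: measurable_funM.
have mSf : measurable_fun D (fun x => (S `^ q^-1)%:E * (f x)%:E).
  exact: emeasurable_funM.
rewrite -ge0_integralZl_EFin//; last by rewrite powR_ge0.
  apply: ae_ge0_le_integral => //.
  - by move=> x _; rewrite lee_fin mulr_ge0// invr_ge0.
  - by move=> x _; rewrite mule_ge0// lee_fin ?powR_ge0.
  move: wS; apply: filterS => x + xD => /(_ xD) wS.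
  rewrite -EFinM lee_fin ler_wpM2r// -(powR_inv1 (w0 x)).
  rewrite (_ : -1 = - q * q^-1)%R; last by rewrite mulNr mulfV// gt_eqF.
  rewrite powRrM; apply: ge0_ler_powR; rewrite ?nnegrE ?powR_ge0 ?invr_ge0 ?(ltW q0)//.
  exact: le_trans (powR_ge0 _ _) wS.
by move=> x _; rewrite lee_fin.
Qed.

Lemma integral_inv_weight_hoelder (D : set T) (f : T -> R) :
  measurable D -> measurable_fun setT f -> (forall x, 0 <= f x)%R -> (1 < p)%R ->
  \int[mu]_(x in D) ((w x)^-1 * f x)%:E <=
  (\int[mu]_(x in D) (f x `^ p)%:E) `^ p^-1 *
  (\int[mu]_(x in D) (w x `^ (- conj_exp p))%:E) `^ (1 - p^-1).
Proof.
move=> mD mf f0 p_1; have p0 : (0 < p)%R by exact: lt_trans p_1.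
have mfp : measurable_fun setT (fun x => f x `^ p)%R.
  exact: (measurableT_comp (measurable_powR p) mf).
have pi : (0 < p^-1 <= 1)%R by rewrite invr_gt0 p0 invf_le1// ltW.
apply: le_trans (integral_powR_mul_le mu mD mfp (mpow _) _ _ pi); last 2 first.
- by move=> x; exact: powR_ge0.
- by move=> x; exact: powR_ge0.
rewrite le_eqVlt; apply/orP; left; apply/eqP; apply: eq_integral => x _.
rewrite -!powRrM mulfV ?gt_eqF// powRr1// mulrC -(powR_inv1 (w0 x)).
rewrite mulNr mulVf ?powR_inv1// subr_eq0 eq_sym.
by rewrite lt_eqF// invf_lt1.
Qed.

(** Hölder, or its substitute at p = 1, bounds the integral of w^-1 f by the second factor of the
    characteristic. Passing from averages to integrals produces the power 1/q + 1/p' of |Q|, with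
    1/p' written as 1 - 1/p. *)
Lemma Apq_cube (f : T -> R) a l : (0 < l)%R ->
  measurable_fun setT f -> (forall x, 0 <= f x)%R ->
  (\int[mu]_(x in cube_of a l) (w x `^ q)%:E) `^ q^-1 *
  \int[mu]_(x in cube_of a l) ((w x)^-1 * f x)%:E <=
  Apq_char p q w `^ q^-1 * ((l ^+ n) `^ (q^-1 + (1 - p^-1)))%:E *
  (\int[mu]_(x in cube_of a l) (f x `^ p)%:E) `^ p^-1.
Proof.
move=> l0 mf f0.
have ln0 : (0 < l ^+ n)%R by rewrite exprn_gt0.
have qi0 : (0 <= q^-1)%R by rewrite invr_ge0 ltW.
pose S := ess_sup mu (fun x => (w x `^ (- q) * \1_(cube_of a l) x)%:E).
have S0 : 0 < S by exact: ess_sup_weight_gt0.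
have SE : {ae mu, forall x, cube_of a l x -> (w x `^ (- q))%:E <= S}.
  move: (ess_sup_ge mu (fun x => (w x `^ (- q) * \1_(cube_of a l) x)%:E)).
  by apply: filterS => x + xQ; rewrite -/S indicE mem_set// mulr1.
have A1 : p = 1%R -> S * average (cube_of a l) (fun x => (w x `^ q)%:E) <=
    Apq_char p q w.
  move=> ->; rewrite /Apq_char eqxx; apply: ereal_sup_ubound.
  by exists (cube_of a l) => //; exists a, l.
have Ap : p != 1%R -> average (cube_of a l) (fun x => (w x `^ q)%:E) *
    average (cube_of a l) (fun x => (w x `^ (- conj_exp p))%:E) `^ (q / conj_exp p) <=
    Apq_char p q w.
  move=> /negPf p_1; rewrite /Apq_char p_1; apply: ereal_sup_ubound.
  by exists (cube_of a l) => //; exists a, l.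
have W0 := average_weight_gt0 q a l0.
have V0 := average_weight_gt0 (- conj_exp p) a l0.
rewrite (integral_averageE (fun x => (w x `^ q)%:E) a l0).
have EV := integral_averageE (fun x => (w x `^ (- conj_exp p))%:E) a l0.
move: W0 V0 A1 Ap EV.
set W := average _ (fun x => (w x `^ q)%:E); set V := average _ _ => W0 V0 A1 Ap EV.
clearbody S W V.
have mQ : measurable (cube_of a l) by exact: measurable_cube_of.
move: (cube_of a l) mQ SE EV => D mD SE EV.
have K0 := Apq_char_gt0; have Ky : Apq_char p q w < +oo by [].
move: (Apq_char p q w) K0 Ky A1 Ap => K K0 Ky A1 Ap.
have F0 : 0 <= \int[mu]_(x in D) (f x `^ p)%:E.
  by apply: integral_ge0 => x _; rewrite lee_fin powR_ge0.
rewrite poweRM ?lee_fin ?(ltW ln0) ?(ltW W0)// -muleA.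
have [p_1|p_1] := eqVneq p 1%R.
  (* The average of w^q being positive, an infinite essential supremum would contradict [wA]. *)
  have Sy : S < +oo.
    rewrite ltNge leye_eq; apply/negP => /eqP Sy; move: (A1 p_1).
    by rewrite Sy gt0_mulye// leye_eq (lt_eqF Ky).
  have finS : S \is a fin_num by rewrite ge0_fin_numE// ltW.
  have SE' : {ae mu, forall x, D x -> (w x `^ (- q) <= fine S)%R}.
    by move: SE; apply: filterS => x + Dx => /(_ Dx); rewrite -lee_fin fineK.
  have := integral_inv_weight_ess mD mf f0 SE'.
  rewrite -poweR_EFin (fineK finS) => H.
  have Ff1 : \int[mu]_(x in D) (f x `^ 1)%:E = \int[mu]_(x in D) (f x)%:E.
    by apply: eq_integral => x _; rewrite powRr1.
  rewrite p_1 in F0 *; rewrite invr1 subrr addr0 (poweRe1 F0) Ff1.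
  rewrite poweR_EFin [X in _ <= X * _]muleC -[leRHS]muleA.
  apply: lee_wpmul2l; first by rewrite lee_fin powR_ge0.
  apply: (@le_trans _ _ (W `^ q^-1 * (S `^ q^-1 * \int[mu]_(x in D) (f x)%:E))).
    by apply: lee_wpmul2l; [exact: poweR_ge0|].
  rewrite muleA -poweRM ?(ltW W0) ?(ltW S0)// muleC [leRHS]muleC.
  apply: lee_wpmul2l; first by apply: integral_ge0 => x _; rewrite lee_fin.
  apply: gt0_ler_poweR => //; last by rewrite muleC A1.
    by rewrite in_itv/= leey andbT mule_ge0// ltW.
  by rewrite in_itv/= leey andbT ltW.
have p_1' : (1 < p)%R by rewrite lt_neqAle eq_sym p_1.
apply: (@le_trans _ _ ((l ^+ n)%:E `^ q^-1 * (W `^ q^-1 *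
   ((\int[mu]_(x in D) (f x `^ p)%:E) `^ p^-1 *
  (\int[mu]_(x in D) (w x `^ (- conj_exp p))%:E) `^ (1 - p^-1))))).
  apply: lee_wpmul2l; first exact: poweR_ge0.
  apply: lee_wpmul2l; first exact: poweR_ge0.
  exact: integral_inv_weight_hoelder.
rewrite EV poweRM ?lee_fin ?(ltW ln0) ?(ltW V0)// !poweR_EFin.
have -> : ((l ^+ n) `^ (q^-1 + (1 - p^-1)) = (l ^+ n) `^ q^-1 * (l ^+ n) `^ (1 - p^-1))%R.
  by rewrite powRD//; apply/implyP => _; rewrite gt_eqF.
have -> : V `^ (1 - p^-1) = (V `^ (q / conj_exp p)) `^ q^-1.
  by rewrite -poweRrM /conj_exp invrK mulrAC mulfV ?mul1r// gt_eqF.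
set L1 := ((l ^+ n) `^ q^-1)%R; set L2 := ((l ^+ n) `^ (1 - p^-1))%R.
set F := _ `^ p^-1; set V' := V `^ _.
have -> : L1%:E * (W `^ q^-1 * (F * (L2%:E * V' `^ q^-1))) =
    (W * V') `^ q^-1 * (L1 * L2)%:E * F.
  rewrite poweRM ?poweR_ge0 ?(ltW W0)// EFinM.
  rewrite -!muleA (muleCA (V' `^ _) L1%:E) (muleCA (W `^ _) L1%:E).
  by rewrite (muleC F) (muleCA (V' `^ _)) -!muleA.
apply: lee_wpmul2r; first exact: poweR_ge0.
apply: lee_wpmul2r; first by rewrite lee_fin mulr_ge0// powR_ge0.
apply: gt0_ler_poweR => //; last exact: Ap.
  by rewrite in_itv/= leey andbT mule_ge0 ?poweR_ge0// ltW.
by rewrite in_itv/= leey andbT ltW.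
Qed.

End apq.

(** * Averaging over cubes of a fixed scale *)

Section tonelli_section.
Context d (T : measurableType d) (R : realType).
Variable mu : {sigma_finite_measure set T -> \bar R}.
Variables (S : set (T * T)) (h : T -> \bar R).
Hypothesis mS : measurable S.
Hypothesis mh : measurable_fun setT h.
Hypothesis h0 : forall x, (0 <= h x)%E.
Local Open Scope ereal_scope.

Let f (k : T -> \bar R) (zy : T * T) : \bar R := k zy.1 * h zy.2 * (\1_S zy)%:E.

Let mf k : measurable_fun setT k -> measurable_fun setT (f k).
Proof.
move=> mk; apply: emeasurable_funM.
  apply: emeasurable_funM; first exact: (measurableT_comp mk measurable_fst).
  exact: (measurableT_comp mh measurable_snd).
have m1 : measurable_fun setT (\1_S : T * T -> R) by exact: measurable_indic.
exact/measurable_EFinP.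
Qed.

Let f0 k zy : (forall x, 0 <= k x) -> 0 <= f k zy.
Proof. by move=> k0; rewrite /f !mule_ge0// lee_fin. Qed.

Let integral_xsection k z : (forall x, 0 <= k x) ->
  k z * \int[mu]_(y in [set y | S (z, y)]) h y = \int[mu]_y f k (z, y).
Proof.
move=> k0; have mSz : measurable [set y | S (z, y)].
  have -> : [set y | S (z, y)] = xsection S z.
    by apply/seteqP; split=> y; rewrite /xsection /= inE.
  exact: measurable_xsection.
have mhS : measurable_fun [set y | S (z, y)] h by exact: measurable_funTS.
rewrite -ge0_integralZl// integral_mkcond; apply: eq_integral => y _.
rewrite patchE /f indicE /=.
have -> : (y \in [set y | S (z, y)]) = ((z, y) \in S).
  by apply/idP/idP => /set_mem ?; apply/mem_set.
by case: (_ \in _); rewrite ?mule1 ?mule0.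
Qed.

Let integral_ysection k y : measurable_fun setT k -> (forall x, 0 <= k x) ->
  h y * \int[mu]_(z in [set z | S (z, y)]) k z = \int[mu]_z f k (z, y).
Proof.
move=> mk k0; have mSy : measurable [set z | S (z, y)].
  have -> : [set z | S (z, y)] = ysection S y.
    by apply/seteqP; split=> z; rewrite /ysection /= inE.
  exact: measurable_ysection.
have mkS : measurable_fun [set z | S (z, y)] k by exact: measurable_funTS.
rewrite -ge0_integralZl// integral_mkcond; apply: eq_integral => z _.
rewrite patchE /f indicE /=.
have -> : (z \in [set z | S (z, y)]) = ((z, y) \in S).
  by apply/idP/idP => /set_mem ?; apply/mem_set.
by case: (_ \in _); rewrite ?mule1 ?mule0// muleC.
Qed.

Lemma measurable_integral_section :
  measurable_fun setT (fun z => \int[mu]_(y in [set y | S (z, y)]) h y).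
Proof.
have c0 (x : T) : 0 <= cst 1 x :> \bar R by [].
have mf1 : measurable_fun setT (f (cst 1)) by apply: mf; exact: measurable_cst.
have f1 zy : 0 <= f (cst 1) zy by exact: f0.
have := @measurable_fun_fubini_tonelli_F _ _ T T R mu (f (cst 1)) mf1 f1.
rewrite (_ : fubini_F _ _ = fun z => \int[mu]_(y in [set y | S (z, y)]) h y)//.
by apply/funext => z; rewrite /fubini_F -integral_xsection// mul1e.
Qed.

Lemma tonelli_section (k : T -> \bar R) :
  measurable_fun setT k -> (forall x, 0 <= k x) ->
  \int[mu]_z (k z * \int[mu]_(y in [set y | S (z, y)]) h y) =
  \int[mu]_y (h y * \int[mu]_(z in [set z | S (z, y)]) k z).
Proof.
move=> mk k0.
under eq_integral do rewrite integral_xsection//.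
under [RHS]eq_integral do rewrite integral_ysection//.
have mfk := mf mk; have fk0 zy := f0 zy k0.
exact: (@fubini_tonelli _ _ T T R mu mu (f k) mfk fk0).
Qed.

End tonelli_section.

Section box_ball.
Context (R : realType) (n : nat).
Local Notation T := (Rn R n).
Local Notation mu := (@lebesgue R n).

(** Sup-norm balls: they are cubes in the sense of the statement, and the relation between centre
    and point is symmetric, as Tonelli's theorem requires. *)
Definition box_ball (z : T) (c : R) : set T :=
  cube_of [tuple tnth z i - c | i < n] (2 * c).

Lemma box_ballP (x z : T) c :
  box_ball z c x <-> forall i, `|tnth x i - tnth z i| <= c.
Proof.
split=> H i; have := H i; rewrite tnth_mktuple ler_norml; lra.
Qed.

Lemma box_ballC (x z : T) c : box_ball z c x -> box_ball x c z.
Proof. by move=> /box_ballP xz; apply/box_ballP => i; rewrite distrC. Qed.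

Lemma measurable_box_ball z c : measurable (box_ball z c).
Proof. exact: measurable_cube_of. Qed.

Lemma lebesgue_box_ball z c : 0 <= c -> mu (box_ball z c) = ((2 * c) ^+ n)%:E.
Proof. by move=> c0; rewrite lebesgue_cube// mulr_ge0. Qed.

Lemma box_ball_sub (x z : T) c : box_ball x c z -> box_ball x c `<=` box_ball z (2 * c).
Proof.
move=> /box_ballP xz y /box_ballP xy; apply/box_ballP => i.
have := xz i; have := xy i; rewrite !ler_norml; lra.
Qed.

Lemma measurable_coord_diff i :
  measurable_fun setT (fun xz : T * T => tnth xz.1 i - tnth xz.2 i : R).
Proof.
apply: measurable_funB.
  exact: (measurableT_comp (measurable_coord i) measurable_fst).
exact: (measurableT_comp (measurable_coord i) measurable_snd).
Qed.

Definition near_diag c : set (T * T) := [set zy | box_ball zy.1 c zy.2].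

Lemma measurable_near_diag c : measurable (near_diag c).
Proof.
rewrite (_ : near_diag c = \bigcap_(i in [set: 'I_n])
   ((fun xz : T * T => tnth xz.1 i - tnth xz.2 i : R) @^-1` `[- c, c]%classic)).
  apply: fin_bigcap_measurable => [|i _]; first exact: finite_finset.
  by rewrite -[X in measurable X]setTI; apply: measurable_coord_diff.
apply/seteqP; split=> [[z y] /= /box_ballP zy i _|[z y] zy]; rewrite /= ?in_itv/=.
  by rewrite -ler_norml distrC.
apply/box_ballP => i /=; have := zy i I.
by rewrite /= in_itv/= -ler_norml distrC.
Qed.

Local Open Scope ereal_scope.

Section tonelli.
Variable (h : T -> \bar R) (c : R).
Hypothesis mh : measurable_fun setT h.
Hypothesis h0 : forall x, 0 <= h x.

Lemma measurable_integral_box_ball :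
  measurable_fun setT (fun z => \int[mu]_(y in box_ball z c) h y).
Proof. exact: (measurable_integral_section mu (measurable_near_diag c) mh h0). Qed.

Lemma tonelli_box_ball (k : T -> \bar R) :
  measurable_fun setT k -> (forall x, 0 <= k x) ->
  \int[mu]_z (k z * \int[mu]_(y in box_ball z c) h y) =
  \int[mu]_y (h y * \int[mu]_(z in box_ball y c) k z).
Proof.
move=> mk k0.
have := tonelli_section mu (measurable_near_diag c) mh h0 mk k0.
move=> ->; apply: eq_integral => y _; congr (_ * integral _ _ _).
by apply/seteqP; split=> z; exact: box_ballC.
Qed.

(** Each y is counted by the centres in [box_ball y c], a set of measure (2c)^n. *)
Lemma integral_integral_box_ball : (0 <= c)%R ->
  \int[mu]_z \int[mu]_(y in box_ball z c) h y =
  ((2 * c) ^+ n)%:E * \int[mu]_y h y.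
Proof.
move=> c0.
have := @tonelli_box_ball (cst 1) (measurable_cst _) (fun=> lee01).
under eq_integral do rewrite mul1e.
move=> ->; rewrite -ge0_integralZl_EFin//; last by rewrite exprn_ge0// mulr_ge0.
apply: eq_integral => y _; rewrite integral_cst ?mul1e; last exact: measurable_box_ball.
by rewrite /= lebesgue_box_ball// muleC.
Qed.

End tonelli.
End box_ball.

(** * The estimate at a single scale *)

Lemma scale_exponents (R : realType) (p q th x b m : R) :
  1 <= p -> 0 < q -> q^-1 <= p^-1 -> 0 < th -> 0 <= x -> x <= m -> 0 < b ->
  (3 * (x / b) `^ th) `^ q^-1 * x `^ (1 - q^-1) * b `^ (q^-1 + (1 - p^-1)) <=
  3 `^ q^-1 * b `^ (q^-1 + (1 - p^-1) - th / q) * m `^ (p^-1 - q^-1 + th / q)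
  * x `^ (1 - p^-1).
Proof.
move=> p1 q0 qp th0 x0 xm b0.
have qi0 : 0 < q^-1 by rewrite invr_gt0.
have m0 : 0 <= m by exact: le_trans xm.
move: x0; rewrite le_eqVlt => /predU1P[<-|x0].
  rewrite mul0r powR0 ?gt_eqF// mulr0 powR0 ?gt_eqF// !mul0r.
  by rewrite !mulr_ge0// powR_ge0.
have PD (c s t : R) : 0 < c -> c `^ (s + t) = c `^ s * c `^ t.
  by move=> c0; rewrite powRD//; apply/implyP => _; rewrite gt_eqF.
have xb : (x / b) `^ th = x `^ th * b `^ (- th).
  rewrite powRM ?invr_ge0 ?(ltW x0) ?(ltW b0)//; congr (_ * _).
  by rewrite -(powR_inv1 (ltW b0)) -powRrM mulN1r.
rewrite xb powRM ?mulr_ge0 ?powR_ge0// powRM ?powR_ge0//.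
rewrite -!powRrM mulNr -/(th / q) (PD b (q^-1 + (1 - p^-1)))//.
(* Only the power 1/p - 1/q of x, together with the decay th/q, is traded for the bound m. The power
   1 - 1/p must survive, since it is the exponent with which |E meet Q| enters Hölder's inequality
   over all cubes. *)
have -> : x `^ (1 - q^-1) = x `^ (1 - p^-1) * x `^ (p^-1 - q^-1).
  by rewrite -PD//; congr (_ `^ _); ring.
apply: (@le_trans _ _ (3 `^ q^-1 * (b `^ (q^-1 + (1 - p^-1)) * b `^ (- (th / q)))
   * (x `^ (p^-1 - q^-1) * x `^ (th / q)) * x `^ (1 - p^-1))).
  by rewrite le_eqVlt; apply/orP; left; apply/eqP; ring.
rewrite ler_wpM2r ?powR_ge0// ler_wpM2l ?mulr_ge0 ?powR_ge0//.
rewrite -PD//; apply: ge0_ler_powR => //; rewrite ?nnegrE//; last exact: ltW.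
by rewrite addr_ge0// ?subr_ge0// divr_ge0// ltW.
Qed.

Section single_scale.
Context (R : realType) (n : nat).
Local Notation T := (Rn R n).
Local Notation mu := (@lebesgue R n).
Variables (p q A : R) (N : nat) (w f : T -> R) (E : set T).
Hypotheses (p1 : 1 <= p) (q0 : 0 < q) (qp : q^-1 <= p^-1).
Hypotheses (wW : weight w) (wA : Apq p q w).
Hypotheses (A0 : 0 <= A) (uA : (Ainfty_char (fun x => w x `^ q)%R <= A%:E)%E).
Hypotheses (N0 : (0 < N)%N) (NA : 2 ^+ n.+2 * A <= N%:R).
Hypotheses (mf : measurable_fun setT f) (f0 : forall x, 0 <= f x).
Hypothesis fp : (\int[mu]_x (f x `^ p)%:E < +oo)%E.
Hypotheses (mE : measurable E) (Ey : (mu E < +oo)%E).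
Local Open Scope ereal_scope.

Local Notation th := (N.+1%:R^-1 : R)%R.
Local Notation M := (fine (mu E)).
Local Notation K := (fine (Apq_char p q w)).

(* [b] is the measure of the averaging cubes; [th] is the decay exponent. *)
Definition scale_const (b : R) : R :=
  (3 `^ q^-1 * K `^ q^-1 * b `^ (q^-1 + (1 - p^-1) - th / q)
  * (Num.min M b) `^ (p^-1 - q^-1 + th / q))%R.

Let mw : measurable_fun setT w. Proof. by have [] := wW. Qed.
Let w0 x : (0 <= w x)%R. Proof. by have [] := wW. Qed.

(** Hölder against the constant 1 passes from w to w^q and costs the power 1 - 1/q of the measure;
    the A_oo decay of w^q then compares E meet Q with Q. *)
Lemma weight_cube_mass_le a l : (0 < l)%R ->
  \int[mu]_(x in E `&` cube_of a l) (w x)%:E <=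
  ((3 * (fine (mu (E `&` cube_of a l)) / l ^+ n) `^ th) `^ q^-1
   * fine (mu (E `&` cube_of a l)) `^ (1 - q^-1))%:E *
  (\int[mu]_(x in cube_of a l) (w x `^ q)%:E) `^ q^-1.
Proof.
move=> l0.
have mu_u : measurable_fun setT (fun x => w x `^ q)%R.
  exact: (measurableT_comp (measurable_powR q) mw).
have mQ : measurable (cube_of a l) by exact: measurable_cube_of.
have mEQ : measurable (E `&` cube_of a l) by exact: measurableI.
have := Ainfty_decay l0 mu_u (fun x => powR_ge0 _ _) A0 uA N0 NA mEQ (@subIsetr _ _ _)
  (weight_cube_lty wW wA a l0).
move: (weight_cube_gt0 wW q a l0).
have finD : mu (E `&` cube_of a l) \is a fin_num.
  by rewrite ge0_fin_numE//; apply: le_lt_trans Ey; exact: le_lebesgue.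
have qi : (0 < q^-1 <= 1)%R.
  by rewrite invr_gt0 q0/= (le_trans qp)// invf_le1// (lt_le_trans _ p1).
have qi0 : (0 <= q^-1)%R by rewrite invr_ge0 ltW.
move: (E `&` cube_of a l) mEQ finD => D mD finD.
move: (cube_of a l) mQ => Q mQ uQ0 decay.
have := integral_powR_mul_le mu mD mu_u (measurable_cst (1%R : R)) (fun x => powR_ge0 _ _)
  (fun=> ler01 : (0 <= 1 :> R)%R) qi.
under eq_integral do rewrite powR1 mulr1 -powRrM mulfV ?gt_eqF// powRr1//.
move=> /le_trans; apply.
rewrite [X in _ * X `^ (1 - q^-1)](_ : _ = mu D); last by rewrite -[RHS]mul1e -integral_cst.
rewrite -[in leLHS](fineK finD) poweR_EFin.
rewrite [in leRHS]mulrC EFinM -muleA muleC.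
apply: lee_wpmul2l; first by rewrite lee_fin powR_ge0.
rewrite -poweR_EFin -poweRM ?lee_fin ?(ltW uQ0)//; last first.
  by rewrite mulr_ge0// powR_ge0.
apply: gt0_ler_poweR => //.
  by rewrite in_itv/= leey andbT; apply: integral_ge0 => x _; rewrite lee_fin powR_ge0.
by rewrite in_itv/= leey andbT mule_ge0 ?(ltW uQ0)// lee_fin mulr_ge0// powR_ge0.
Qed.

(** All dependence on the position of the cube is left in two factors with conjugate exponents 1/p
    and 1 - 1/p, ready for Hölder's inequality in the centre. *)
Lemma cube_scale_bound a l : (0 < l)%R ->
  \int[mu]_(x in cube_of a l) ((w x)^-1 * f x)%:E *
  \int[mu]_(x in E `&` cube_of a l) (w x)%:E <=
  (scale_const (l ^+ n) * (fine (\int[mu]_(x in cube_of a l) (f x `^ p)%:E) `^ p^-1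
   * fine (mu (E `&` cube_of a l)) `^ (1 - p^-1)))%:E.
Proof.
move=> l0.
have ln0 : (0 < l ^+ n)%R by rewrite exprn_gt0.
have finF : \int[mu]_(x in cube_of a l) (f x `^ p)%:E \is a fin_num.
  rewrite ge0_fin_numE; last by apply: integral_ge0 => x _; rewrite lee_fin powR_ge0.
  apply: le_lt_trans fp; apply: ge0_subset_integral.
  - exact: measurable_cube_of.
  - exact: measurableT.
  - by apply/measurable_EFinP; exact: (measurableT_comp (measurable_powR p) mf).
  - by move=> x _; rewrite lee_fin powR_ge0.
  - exact: subsetT.
have xm : (fine (mu (E `&` cube_of a l)) <= Num.min M (l ^+ n))%R.
  have finE : mu E \is a fin_num by rewrite ge0_fin_numE.
  have cQ := lebesgue_cube a (ltW l0).
  have finEQ : mu (E `&` cube_of a l) \is a fin_num.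
    by rewrite ge0_fin_numE//; apply: le_lt_trans Ey; exact: le_lebesgue.
  rewrite le_min; apply/andP; split; first by apply: fine_le => //; exact: le_lebesgue.
  by rewrite -lee_fin fineK// -cQ; exact: le_lebesgue.
have finK : Apq_char p q w \is a fin_num.
  by rewrite ge0_fin_numE// ltW// Apq_char_gt0.
apply: (@le_trans _ _ (\int[mu]_(x in cube_of a l) ((w x)^-1 * f x)%:E * _)).
  apply: lee_wpmul2l; last exact: weight_cube_mass_le.
  by apply: integral_ge0 => x _; rewrite lee_fin mulr_ge0// invr_ge0.
rewrite muleC -muleA.
set x := fine (mu (E `&` _)) in xm *; set F := \int[mu]_(x in _) (f x `^ p)%:E in finF *.
have x0 : (0 <= x)%R by rewrite fine_ge0.
apply: (@le_trans _ _ (((3 * (x / l ^+ n) `^ th) `^ q^-1 * x `^ (1 - q^-1))%:E *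
   (Apq_char p q w `^ q^-1 * ((l ^+ n) `^ (q^-1 + (1 - p^-1)))%:E * F `^ p^-1))).
  apply: lee_wpmul2l; first by rewrite lee_fin mulr_ge0// powR_ge0.
  exact: Apq_cube.
have th0 : (0 < th)%R by rewrite invr_gt0.
rewrite -[in leLHS](fineK finK) -[in leLHS](fineK finF) !poweR_EFin -!EFinM lee_fin.
have := scale_exponents p1 q0 qp th0 x0 xm ln0.
set F' := (fine F `^ p^-1)%R; set K' := (K `^ q^-1)%R => H.
have FK : (0 <= F' * K')%R by rewrite mulr_ge0// powR_ge0.
have := ler_wpM2r FK H; rewrite /scale_const -/K'.
move=> H'; apply: le_trans (le_trans H' _); rewrite le_eqVlt; apply/orP; left; apply/eqP; ring.
Qed.

Let minv : measurable_fun setT (fun x => (w x)^-1)%R.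
Proof. exact: measurable_fun_inv_ge0. Qed.

Let g y : \bar R := ((w y)^-1 * f y)%:E.

Let mg : measurable_fun setT g.
Proof. by apply/measurable_EFinP; exact: measurable_funM. Qed.

Let g0 y : 0 <= g y. Proof. by rewrite lee_fin mulr_ge0// invr_ge0. Qed.

(* A cube of radius [2 l] centred in [box_ball x l] contains [box_ball x l]. *)
Lemma scale_averaging l : (0 < l)%R ->
  ((2 * l) ^+ n)%:E * \int[mu]_(x in E) ((w x)%:E * \int[mu]_(y in box_ball x l) g y) <=
  \int[mu]_z (\int[mu]_(y in box_ball z (2 * l)) g y *
              \int[mu]_(x in E `&` box_ball z (2 * l)) (w x)%:E).
Proof.
move=> l0; pose h x : \bar R := (w x * \1_E x)%:E.
have mh : measurable_fun setT h.
  have mI : measurable_fun setT (\1_E : T -> R) by exact: measurable_indic.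
  exact/measurable_EFinP/(measurable_funM mw mI).
have h0 x : 0 <= h x by rewrite lee_fin mulr_ge0.
have G0 c z : 0 <= \int[mu]_(y in box_ball z c) g y by exact: integral_ge0.
have mG c : measurable_fun setT (fun z => \int[mu]_(y in box_ball z c) g y).
  exact: measurable_integral_box_ball.
have -> : \int[mu]_z (\int[mu]_(y in box_ball z (2 * l)) g y *
              \int[mu]_(x in E `&` box_ball z (2 * l)) (w x)%:E) =
    \int[mu]_x (h x * \int[mu]_(z in box_ball x (2 * l))
                        \int[mu]_(y in box_ball z (2 * l)) g y).
  rewrite -(tonelli_box_ball (2 * l) mh h0 (mG _) (G0 _)).
  apply: eq_integral => z _; congr (_ * _).
  rewrite setIC integral_mkcondr; apply: eq_integral => x _.
  by rewrite patchE /h indicE; case: (x \in E); rewrite ?mulr1 ?mulr0.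
have l0' : (0 <= (2 * l) ^+ n)%R by rewrite exprn_ge0// mulr_ge0// ltW.
have mwG : measurable_fun E (fun x => (w x)%:E * \int[mu]_(y in box_ball x l) g y).
  have mwE : measurable_fun setT (fun x => (w x)%:E) by exact/measurable_EFinP.
  exact: measurable_funTS (emeasurable_funM mwE (mG l)).
rewrite -(ge0_integralZl_EFin mu mE _ mwG l0'); last first.
  by move=> x _; rewrite mule_ge0// lee_fin.
rewrite integral_mkcond; apply: le_ge0_integral => x _.
  by rewrite patchE; case: ifP => // _; rewrite !mule_ge0// lee_fin.
rewrite patchE /h indicE; case: (x \in E); last by rewrite mulr0 mul0e.
rewrite mulr1 muleCA; apply: lee_wpmul2l; first by rewrite lee_fin.
rewrite -(lebesgue_box_ball x (ltW l0)) muleC -integral_cst; last exact: measurable_box_ball.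
apply: (@le_trans _ _ (\int[mu]_(z in box_ball x l) \int[mu]_(y in box_ball z (2 * l)) g y)).
  apply: le_ge0_integral => z xz; first exact: G0.
  apply: ge0_subset_integral.
  - exact: measurable_box_ball.
  - exact: measurable_box_ball.
  - exact: measurable_funTS.
  - by move=> y _; exact: g0.
  - exact: box_ball_sub.
apply: ge0_subset_integral.
- exact: measurable_box_ball.
- exact: measurable_box_ball.
- exact: measurable_funTS.
- by move=> y _; exact: G0.
- by move=> z /box_ballP xz; apply/box_ballP => i; apply: le_trans (xz i) _; lra.
Qed.

(** Hölder's inequality in the centre z. Both integrals over z carry the measure b = (4l)^n of the
    averaging cubes, to powers adding up to 1; dividing by the (2l)^n of [scale_averaging] leaves
    2^n. *)
Lemma single_scale l : (0 < l)%R ->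
  \int[mu]_(x in E) ((w x)%:E * \int[mu]_(y in box_ball x l) g y) <=
  (2 ^+ n * scale_const ((4 * l) ^+ n) *
   (fine (\int[mu]_x (f x `^ p)%:E) `^ p^-1 * M `^ (1 - p^-1)))%:E.
Proof.
move=> l0; pose c := (2 * l)%R; have c0 : (0 < c)%R by rewrite mulr_gt0.
have -> : (4 * l = 2 * c)%R by rewrite /c; ring.
have c20 : (0 < 2 * c)%R by rewrite mulr_gt0.
set b := ((2 * c) ^+ n)%R; have b0 : (0 < b)%R by rewrite exprn_gt0.
pose F z := fine (\int[mu]_(y in box_ball z c) (f y `^ p)%:E).
pose e z := fine (mu (E `&` box_ball z c)).
have mfp : measurable_fun setT (fun x => (f x `^ p)%:E).
  by apply/measurable_EFinP; exact: (measurableT_comp (measurable_powR p) mf).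
have fp0 x : 0 <= (f x `^ p)%:E by rewrite lee_fin powR_ge0.
have mI : measurable_fun setT (fun x : T => (\1_E x)%:E : \bar R).
  by apply/measurable_EFinP; exact: measurable_indic.
have I0 (x : T) : 0 <= (\1_E x)%:E :> \bar R by rewrite lee_fin.
have eE z : \int[mu]_(x in box_ball z c) (\1_E x)%:E = (e z)%:E.
  rewrite integral_indic//; last exact: measurable_box_ball.
  rewrite /e fineK// ge0_fin_numE//; apply: le_lt_trans Ey.
  by apply: le_lebesgue; exact: subIsetl.
have FE z : \int[mu]_(x in box_ball z c) (f x `^ p)%:E = (F z)%:E.
  rewrite /F fineK// ge0_fin_numE; last by apply: integral_ge0 => x _; exact: fp0.
  apply: le_lt_trans fp; apply: ge0_subset_integral.
  - exact: measurable_box_ball.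
  - exact: measurableT.
  - exact: mfp.
  - by move=> x _; exact: fp0.
  - exact: subsetT.
have me : measurable_fun setT e.
  apply/measurable_EFinP; rewrite (_ : EFin \o e = fun z =>
    \int[mu]_(x in box_ball z c) (\1_E x)%:E); last by apply/funext => z /=; rewrite eE.
  exact: measurable_integral_box_ball.
have mF : measurable_fun setT F.
  apply/measurable_EFinP; rewrite (_ : EFin \o F = fun z =>
    \int[mu]_(x in box_ball z c) (f x `^ p)%:E); last by apply/funext => z /=; rewrite FE.
  exact: measurable_integral_box_ball.
have e0 z : (0 <= e z)%R by rewrite fine_ge0.
have F0 z : (0 <= F z)%R.
  by rewrite fine_ge0//; apply: integral_ge0 => x _; exact: fp0.
have pi : (0 < p^-1 <= 1)%R.
  by rewrite invr_gt0 (lt_le_trans _ p1)//= invf_le1// (lt_le_trans _ p1).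
have /andP[pi0 pi1] := pi.
have C0 : (0 <= scale_const b)%R by rewrite !mulr_ge0// powR_ge0.
have intF : \int[mu]_z (F z)%:E = (b * fine (\int[mu]_x (f x `^ p)%:E))%:E.
  under eq_integral do rewrite -FE.
  rewrite integral_integral_box_ball ?(ltW c0)// EFinM fineK// ge0_fin_numE//.
  by apply: integral_ge0 => x _; exact: fp0.
have inte : \int[mu]_z (e z)%:E = (b * M)%:E.
  under eq_integral do rewrite -eE.
  rewrite integral_integral_box_ball ?(ltW c0)// EFinM integral_indic// setIT.
  by rewrite fineK// ge0_fin_numE.
have := integral_powR_mul_le mu measurableT mF me F0 e0 pi.
rewrite intF inte => H.
have mFe : measurable_fun setT (fun z => (F z `^ p^-1 * e z `^ (1 - p^-1))%:E).
  apply/measurable_EFinP; apply: measurable_funM.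
    exact: (measurableT_comp (measurable_powR _) mF).
  exact: (measurableT_comp (measurable_powR _) me).
rewrite -(@lee_pmul2l _ ((2 * l) ^+ n)%:E)//; last by rewrite lte_fin exprn_gt0.
apply: le_trans (scale_averaging l0) _.
apply: (@le_trans _ _ (\int[mu]_z ((scale_const b)%:E *
    (F z `^ p^-1 * e z `^ (1 - p^-1))%:E))).
  apply: le_ge0_integral => z _.
    rewrite mule_ge0//; first exact: integral_ge0.
    by apply: integral_ge0 => x _; rewrite lee_fin.
  rewrite -EFinM; exact: cube_scale_bound.
rewrite ge0_integralZl_EFin//; last by move=> z _; rewrite lee_fin mulr_ge0// powR_ge0.
apply: le_trans (lee_wpmul2l _ H) _; first by rewrite lee_fin.
rewrite !poweR_EFin -!EFinM lee_fin le_eqVlt; apply/orP; left; apply/eqP.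
have M0 : (0 <= M)%R by rewrite fine_ge0.
have Fp0 : (0 <= fine (\int[mu]_x (f x `^ p)%:E))%R.
  by rewrite fine_ge0//; apply: integral_ge0 => x _; exact: fp0.
rewrite !powRM ?(ltW b0)//.
have bb : (b `^ p^-1 * b `^ (1 - p^-1) = b)%R.
  rewrite -powRD; last by apply/implyP => _; rewrite gt_eqF.
  by rewrite subrKC powRr1// ltW.
have bE : b = (2 ^+ n * (2 * l) ^+ n)%R by rewrite -exprMn.
set Fq := (fine _ `^ p^-1)%R; set Mq := (M `^ _)%R.
transitivity (scale_const b * (b `^ p^-1 * b `^ (1 - p^-1)) * (Fq * Mq))%R; first by ring.
by rewrite bb [X in (_ * X * _)%R]bE; ring.
Qed.

End single_scale.

(** * Dyadic decomposition of the kernel *)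

Lemma le_nneseries_term (R : realType) (u : nat -> \bar R) k :
  (forall i, (0 <= u i)%E) -> (u k <= \sum_(i <oo) u i)%E.
Proof.
move=> u0; rewrite (@nneseriesD1 _ u k)// leeDl//.
by apply: nneseries_ge0 => i _ _; exact: u0.
Qed.

Lemma nneseries_le_ub (R : realType) (u : nat -> \bar R) (X : \bar R) :
  (forall i, (0 <= u i)%E) -> (forall m, (\sum_(0 <= i < m) u i <= X)%E) ->
  (\sum_(i <oo) u i <= X)%E.
Proof.
move=> u0 uX; apply: lime_le; last by apply: nearW => m; exact: uX.
by apply: is_cvg_nneseries => i _ _; exact: u0.
Qed.

Lemma sum_geometric_le (R : realType) (x : R) m : 0 <= x < 1 ->
  \sum_(0 <= i < m) x ^+ i <= (1 - x)^-1.
Proof.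
move=> /andP[x0 x1]; have x1' : 0 < 1 - x by rewrite subr_gt0.
have -> : \sum_(0 <= i < m) x ^+ i = (1 - x ^+ m) / (1 - x).
  elim: m => [|m IH]; first by rewrite big_nil expr0 subrr mul0r.
  rewrite big_nat_recr//= IH exprS; field; rewrite gt_eqF//.
by rewrite -[leRHS]mul1r ler_wpM2r ?invr_ge0 ?(ltW x1')// gerBl exprn_ge0.
Qed.

Section kernel.
Context (R : realType) (n : nat).
Local Notation T := (Rn R n).
Local Notation mu := (@lebesgue R n).

Lemma coord_le_eucl_dist (x y : T) i : `|tnth x i - tnth y i| <= eucl_dist x y.
Proof.
rewrite -sqrtr_sqr; apply: ler_wsqrtr.
rewrite (bigD1 i)//= lerDl; apply: sumr_ge0 => j _; exact: sqr_ge0.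
Qed.

Lemma eucl_distxx (x : T) : eucl_dist x x = 0.
Proof.
rewrite /eucl_dist big1 ?sqrtr0// => i _.
by rewrite subrr expr0n.
Qed.

Lemma box_ballPn (x y : T) c : ~ box_ball x c y -> c < eucl_dist x y.
Proof.
move=> xy; rewrite ltNge; apply/negP => yx; apply: xy; apply/box_ballP => i.
by rewrite distrC; apply: le_trans yx; exact: coord_le_eucl_dist.
Qed.

Lemma le_box_ball (x y : T) c c' : c <= c' -> box_ball x c y -> box_ball x c' y.
Proof. by move=> cc /box_ballP xy; apply/box_ballP => i; exact: le_trans cc. Qed.

(** Together the two sequences run once through all r 2^m, m an integer, so the bilateral sum
    becomes two sums over [nat]. *)
Definition small_scale (r : R) k := r * 2^-1 ^+ k.
Definition large_scale (r : R) k := r * 2 ^+ k.+1.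

(** The least k at which y has left the shrinking boxes, or entered the growing ones, singles out a
    shell; both searches start from [box_ball x r]. *)
Lemma box_ball_scale (x y : T) r : 0 < r -> x <> y ->
  exists k, (box_ball x (small_scale r k) y /\ ~ box_ball x (small_scale r k / 2) y) \/
            (box_ball x (large_scale r k) y /\ ~ box_ball x (large_scale r k / 2) y).
Proof.
move=> r0 xy; have [rxy|rxy] := pselect (box_ball x r y).
  have ex : exists k, ~~ `[< box_ball x (small_scale r k) y >].
    have /existsNP[i xyi] : ~ forall i, tnth x i = tnth y i.
      by move=> H; apply: xy; exact: eq_from_tnth.
    have d0 : 0 < `|tnth y i - tnth x i| by rewrite normr_gt0 subr_eq0; apply/eqP => /esym.
    exists (Num.truncn (r / `|tnth y i - tnth x i|)).+1; apply/asboolPn => /box_ballP/(_ i).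
    rewrite leNgt => /negP; apply.
    rewrite /small_scale exprVn ltr_pdivrMr ?exprn_gt0// mulrC -ltr_pdivrMr//.
    by apply: lt_trans (truncnS_gt _) _; rewrite -natrX ltr_nat ltn_expl.
  case: (ex_minnP ex) => -[|k] /asboolPn kn kmin.
    by exfalso; apply: kn; rewrite /small_scale expr0 mulr1.
  exists k; left; split; last first.
    by move: kn; rewrite /small_scale exprS [2^-1 * _]mulrC mulrA.
  apply: contrapT => nk; have := kmin k; rewrite ltnn => /(_ _) H.
  by have := H (introN (asboolP _) nk).
have ex : exists k, `[< box_ball x (r * 2 ^+ k) y >].
  pose d := eucl_dist x y; exists (Num.truncn (d / r)).+1; apply/asboolP.
  apply: (@le_box_ball _ _ d).
    rewrite mulrC -ler_pdivrMr// ltW//; apply: lt_trans (truncnS_gt _) _.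
    by rewrite -natrX ltr_nat ltn_expl.
  by apply/box_ballP => i; rewrite distrC; exact: coord_le_eucl_dist.
case: (ex_minnP ex) => -[|k] /asboolP ky kmin.
  by exfalso; apply: rxy; move: ky; rewrite expr0 mulr1.
exists k; right; split; first exact: ky.
rewrite /large_scale exprS [2 * _]mulrC mulrA mulfK// => /asboolP/kmin.
by rewrite ltnn.
Qed.

Lemma kernel_le (x y : T) l s : 0 < l -> 0 <= s -> ~ box_ball x (l / 2) y ->
  (eucl_dist x y `^ s)^-1 <= (l / 2) `^ (- s).
Proof.
move=> l0 s0 /box_ballPn lxy; have l20 : 0 < l / 2 by rewrite divr_gt0.
have d0 := lt_trans l20 lxy.
rewrite powRN lef_pV2 ?posrE ?(powR_gt0 _ l20) ?(powR_gt0 _ d0)//.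
by apply: ge0_ler_powR; rewrite ?nnegrE ?(ltW l20) ?(ltW d0) ?(ltW lxy).
Qed.

Lemma measurable_eucl_dist :
  measurable_fun setT (fun xy : T * T => eucl_dist xy.1 xy.2).
Proof.
rewrite (_ : (fun _ => _) = fun xy : T * T =>
    (\sum_(i < n) (tnth xy.1 i - tnth xy.2 i) ^+ 2) `^ 2^-1).
  apply: (measurableT_comp (measurable_powR _)).
  apply: measurable_sum => i; apply: measurable_funX.
  exact: measurable_coord_diff.
apply/funext => xy; rewrite /eucl_dist powR12_sqrt//.
by apply: sumr_ge0 => i _; exact: sqr_ge0.
Qed.

Local Open Scope ereal_scope.

Lemma measurable_frac_integral alpha (g : T -> R) : measurable_fun setT g ->
  (forall x, 0 <= g x)%R -> measurable_fun setT (frac_integral alpha g).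
Proof.
move=> mg g0.
pose k (xy : T * T) : \bar R := (g xy.2 / eucl_dist xy.1 xy.2 `^ (n%:R - alpha))%:E.
have mk : measurable_fun setT k.
  apply/measurable_EFinP; apply: measurable_funM.
    exact: (measurableT_comp mg measurable_snd).
  rewrite (_ : (fun _ => _) = fun xy : T * T => eucl_dist xy.1 xy.2 `^ (- (n%:R - alpha)))%R.
    exact: (measurableT_comp (measurable_powR _) measurable_eucl_dist).
  by apply/funext => xy; rewrite powRN.
have k0 xy : 0 <= k xy by rewrite lee_fin divr_ge0// powR_ge0.
exact: (@measurable_fun_fubini_tonelli_F _ _ T T R mu k mk k0).
Qed.

(** An upper bound for the kernel on the shell between [box_ball x (l / 2)] and [box_ball x l]. *)
Definition scale_coef alpha l : R := ((l / 2) `^ (- (n%:R - alpha)))%R.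

Lemma frac_integral_le_scales alpha (g : T -> R) r x :
  (0 < alpha < n%:R)%R -> (0 < r)%R -> measurable_fun setT g ->
  (forall x, 0 <= g x)%R ->
  frac_integral alpha g x <= \sum_(k <oo)
   ((scale_coef alpha (small_scale r k))%:E *
      \int[mu]_(y in box_ball x (small_scale r k)) (g y)%:E +
    (scale_coef alpha (large_scale r k))%:E *
      \int[mu]_(y in box_ball x (large_scale r k)) (g y)%:E).
Proof.
move=> /andP[a0 an] r0 mg g0.
have na0 : (0 < n%:R - alpha)%R by rewrite subr_gt0.
pose h l (y : T) : \bar R := (scale_coef alpha l)%:E * ((g y)%:E * (\1_(box_ball x l) y)%:E).
have h0 l y : 0 <= h l y by rewrite !mule_ge0 ?lee_fin ?powR_ge0.
have mI l : measurable_fun setT (fun y : T => (g y)%:E * (\1_(box_ball x l) y)%:E : \bar R).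
  have m1 : measurable_fun setT (\1_(box_ball x l) : T -> R).
    by apply: measurable_indic; exact: measurable_box_ball.
  by apply: emeasurable_funM; exact/measurable_EFinP.
have mh l : measurable_fun setT (h l).
  by apply: emeasurable_funM => //; exact: mI.
have hE l : \int[mu]_y h l y =
    (scale_coef alpha l)%:E * \int[mu]_(y in box_ball x l) (g y)%:E.
  rewrite ge0_integralZl_EFin ?powR_ge0//; last by move=> y _; rewrite mule_ge0// lee_fin.
  congr (_ * _); rewrite [RHS]integral_mkcond; apply: eq_integral => y _.
  by rewrite patchE indicE; case: (y \in _); rewrite ?mule1 ?mule0.
pose S k y := h (small_scale r k) y + h (large_scale r k) y.
have mS k : measurable_fun setT (S k) by exact: emeasurable_funD (mh _) (mh _).
have S0 k y : 0 <= S k y by exact: adde_ge0.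
have SE k : (scale_coef alpha (small_scale r k))%:E *
      \int[mu]_(y in box_ball x (small_scale r k)) (g y)%:E +
    (scale_coef alpha (large_scale r k))%:E *
      \int[mu]_(y in box_ball x (large_scale r k)) (g y)%:E = \int[mu]_y S k y.
  rewrite -!hE /S (ge0_integralD mu measurableT _ (mh _) _ (mh _))//.
under eq_eseriesr do rewrite SE.
rewrite -(@integral_nneseries _ _ _ mu _ measurableT S mS (fun k y _ => S0 k y)).
apply: le_ge0_integral => y _; first by rewrite lee_fin divr_ge0// powR_ge0.
(* On the diagonal, which belongs to no shell, the kernel has the default value 0. *)
have [<-|xy] := pselect (x = y).
  rewrite eucl_distxx powR0 ?gt_eqF// invr0 mulr0.
  by apply: nneseries_ge0 => k _ _; exact: adde_ge0.
have key l : (0 < l)%R -> box_ball x l y -> ~ box_ball x (l / 2) y ->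
    (g y / eucl_dist x y `^ (n%:R - alpha))%:E <= h l y.
  move=> l0 xyl nxy; rewrite /h indicE mem_set// mule1 -EFinM lee_fin mulrC.
  by rewrite ler_wpM2r//; apply: kernel_le => //; exact: ltW.
have [k [[b nb]|[b nb]]] := box_ball_scale r0 xy.
  apply: le_trans (@le_nneseries_term _ _ k _); last by move=> i; exact: adde_ge0.
  apply: le_trans (key _ _ b nb) _; last by rewrite leeDl.
  by rewrite mulr_gt0// exprn_gt0.
apply: le_trans (@le_nneseries_term _ _ k _); last by move=> i; exact: adde_ge0.
apply: le_trans (key _ _ b nb) _; last by rewrite leeDr.
by rewrite mulr_gt0// exprn_gt0.
Qed.

End kernel.

(** * Summation over the scales *)

Lemma powR_half_lt1 (R : realType) (e : R) : 0 < e -> 0 <= (2 `^ (- e) : R) < 1.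
Proof.
move=> e0; rewrite powR_ge0/= powRN invf_lt1 ?powR_gt0//.
apply: (@le_lt_trans _ _ (1 `^ e)); first by rewrite powR1.
by apply: gt0_ltr_powR; rewrite ?nnegrE// ltr1n.
Qed.

Section strong_bound.
Context (R : realType) (n : nat).
Local Notation T := (Rn R n).
Local Notation mu := (@lebesgue R n).
Variables (alpha p q A : R) (N : nat) (w f : T -> R) (E : set T).
Hypotheses (a0 : 0 < alpha) (an : alpha < n%:R).
Hypotheses (p1 : 1 <= p) (q0 : 0 < q) (pq : p^-1 - q^-1 = alpha / n%:R).
Hypotheses (wW : weight w) (wA : Apq p q w).
Hypotheses (A0 : 0 <= A) (uA : (Ainfty_char (fun x => w x `^ q)%R <= A%:E)%E).
Hypotheses (N0 : (0 < N)%N) (NA : 2 ^+ n.+2 * A <= N%:R).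
Hypotheses (mf : measurable_fun setT f) (f0 : forall x, 0 <= f x).
Hypothesis fp : (\int[mu]_x (f x `^ p)%:E < +oo)%E.
Hypotheses (mE : measurable E) (E0 : (0 < mu E)%E) (Ey : (mu E < +oo)%E).
Local Notation th := (N.+1%:R^-1 : R)%R.
Local Notation M := (fine (mu E)).
Local Notation K := (fine (Apq_char p q w)).
Local Notation ex := (n%:R * th / q)%R.
Local Notation sconst := (scale_const p q N w E).
Local Notation kernel_const := (8 `^ (n%:R - alpha) * 3 `^ q^-1 * K `^ q^-1)%R.

Let n0 : 0 < n%:R :> R. Proof. exact: lt_trans an. Qed.
Let qp : q^-1 <= p^-1. Proof. by rewrite -subr_ge0 pq divr_ge0// ltW. Qed.
Let M0 : 0 < M. Proof. by rewrite fine_gt0// E0. Qed.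

Let PD (c s t : R) : 0 < c -> c `^ (s + t) = c `^ s * c `^ t.
Proof. by move=> c0; rewrite powRD//; apply/implyP => _; rewrite gt_eqF. Qed.

(** Since n(1/p - 1/q) = alpha, the power of b = (4l)^n is (4l)^(n - alpha - ex), and its main part
    cancels the kernel. The 8 is the ratio of 4l to l/2. *)
Lemma scale_product l y : 0 < l -> 0 < y -> Num.min M ((4 * l) ^+ n) = y ^+ n ->
  scale_coef n alpha l * sconst ((4 * l) ^+ n) =
  kernel_const * ((4 * l) `^ (- ex) * y `^ (alpha + ex)).
Proof.
move=> l0 y0 my; rewrite /scale_const my /scale_coef.
have x0 : 0 < 4 * l by rewrite mulr_gt0.
set x := 4 * l in x0 *.
have -> : l / 2 = 8^-1 * x by rewrite /x; field.
rewrite powRM ?invr_ge0 ?(ltW x0)//.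
have -> : 8^-1 `^ (- (n%:R - alpha)) = 8 `^ (n%:R - alpha) :> R.
  by rewrite -[8^-1]powR_inv1// -powRrM mulN1r opprK.
rewrite -!(powR_mulrn n) ?(ltW x0) ?(ltW y0)// -!powRrM.
have -> : n%:R * (p^-1 - q^-1 + th / q) = alpha + ex.
  by rewrite pq mulrDr mulrCA mulfV ?gt_eqF// mulr1 mulrA.
have -> : n%:R * (q^-1 + (1 - p^-1) - th / q) = n%:R - alpha - ex.
  have -> : q^-1 + (1 - p^-1) - th / q = 1 - alpha / n%:R - th / q by rewrite -pq; ring.
  by rewrite !mulrBr mulr1 mulrCA mulfV ?gt_eqF// mulr1 mulrA.
have -> : x `^ (n%:R - alpha - ex) = x `^ (n%:R - alpha) * x `^ (- ex) by rewrite PD.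
have xx : x `^ (- (n%:R - alpha)) * x `^ (n%:R - alpha) = 1.
  by rewrite -PD// addNr powRr0.
transitivity (kernel_const * (x `^ (- ex) * y `^ (alpha + ex)) *
  (x `^ (- (n%:R - alpha)) * x `^ (n%:R - alpha))); last by rewrite xx mulr1.
by ring.
Qed.

Local Notation d := (M `^ n%:R^-1).
(* At scale [r] the averaging cubes, of side [4 r], have the measure of [E]. *)
Local Notation r := (d / 4).

Let d0 : 0 < d. Proof. exact: powR_gt0. Qed.
Let dn : d ^+ n = M.
Proof. by rewrite -powR_mulrn ?(ltW d0)// -powRrM mulVf ?powRr1 ?gt_eqF// ltW. Qed.
Let r0 : 0 < r. Proof. by rewrite divr_gt0. Qed.

Let natpow (c e : R) k : 0 < c -> (c ^+ k) `^ e = (c `^ e) ^+ k.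
Proof.
by move=> c0; rewrite -(powR_mulrn _ (ltW c0)) -powRrM mulrC powRrM powR_mulrn// powR_ge0.
Qed.

Lemma small_scale_product k :
  scale_coef n alpha (small_scale r k) * sconst ((4 * small_scale r k) ^+ n) =
  kernel_const * d `^ alpha * (2 `^ (- alpha)) ^+ k.
Proof.
have h0 : 0 < 2^-1 ^+ k :> R by rewrite exprn_gt0.
have E4 : 4 * small_scale r k = d * 2^-1 ^+ k by rewrite /small_scale; field.
have x0 : 0 < d * 2^-1 ^+ k by rewrite mulr_gt0.
rewrite (@scale_product _ (d * 2^-1 ^+ k))//; first last.
- rewrite E4; apply/min_idPr; rewrite -[leRHS]dn.
  apply: lerXn2r; rewrite ?nnegrE ?(ltW x0) ?(ltW d0)//.
  by rewrite ler_piMr ?(ltW d0)// exprn_ile1// invf_le1// ler1n.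
- by rewrite mulr_gt0.
rewrite E4 -PD// addrCA addNr addr0 powRM ?(ltW d0) ?(ltW h0)// natpow//.
have -> : 2^-1 `^ alpha = 2 `^ (- alpha) :> R.
  by rewrite -[2^-1]powR_inv1// -powRrM mulN1r.
by rewrite mulrA.
Qed.

Lemma large_scale_product k :
  scale_coef n alpha (large_scale r k) * sconst ((4 * large_scale r k) ^+ n) =
  kernel_const * d `^ alpha * (2 `^ (- ex)) ^+ k.+1.
Proof.
have h0 : 0 < 2 ^+ k.+1 :> R by rewrite exprn_gt0.
have E4 : 4 * large_scale r k = d * 2 ^+ k.+1 by rewrite /large_scale; field.
rewrite (@scale_product _ d)//; first last.
- rewrite E4 dn; apply/min_idPl; rewrite -[leLHS]dn.
  apply: lerXn2r; rewrite ?nnegrE ?(ltW d0) ?mulr_ge0 ?(ltW d0) ?(ltW h0)//.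
  by rewrite ler_peMr ?(ltW d0)// exprn_ege1// ler1n.
- by rewrite mulr_gt0.
rewrite E4 powRM ?(ltW d0) ?(ltW h0)// natpow//.
have <- : d `^ (- ex) * d `^ (alpha + ex) = d `^ alpha.
  by rewrite -PD// addrCA addNr addr0.
by ring.
Qed.

Local Open Scope ereal_scope.
Let g y := ((w y)^-1 * f y)%R.
Let mw : measurable_fun setT w. Proof. by have [] := wW. Qed.
Let w0 x : (0 <= w x)%R. Proof. by have [] := wW. Qed.
Let mg : measurable_fun setT g.
Proof. exact: measurable_funM (measurable_fun_inv_ge0 mw w0) mf. Qed.
Let g0 y : (0 <= g y)%R. Proof. by rewrite mulr_ge0// invr_ge0. Qed.

(** The two summands come from the geometric series over small and large scales. [B] stands for N +
    1, kept as a parameter so that it can later be exchanged for a multiple of A. *)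
Definition strong_const (B : R) : R :=
  (2 ^+ n * 8 `^ (n%:R - alpha) * 3 `^ q^-1 *
   ((1 - 2 `^ (- alpha))^-1 + B * (1 - 2 `^ (- (n%:R / q)))^-1))%R.

(* The loss [1 / th] responsible for the factor [w^q]_{A_oo}. *)
Lemma large_ratio_le : ((1 - 2 `^ (- ex))^-1 <= N.+1%:R * (1 - 2 `^ (- (n%:R / q)))^-1 :> R)%R.
Proof.
have ex0 : (0 < ex)%R by rewrite divr_gt0// mulr_gt0// invr_gt0.
have v0 : (0 <= 2 `^ (- ex) :> R)%R by exact: powR_ge0.
have v1 : (2 `^ (- ex) < 1 :> R)%R by have /andP[] := powR_half_lt1 ex0.
have E1 : (2 `^ (- (n%:R / q)) = (2 `^ (- ex)) ^+ N.+1 :> R)%R.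
  rewrite -powR_mulrn// -powRrM; congr (_ `^ _)%R.
  by field; rewrite !gt_eqF// ltr0n.
have w1 : (2 `^ (- (n%:R / q)) < 1 :> R)%R.
  by rewrite E1 exprn_ilt1.
(* With v = 2^(-ex) this reads 1 - v^(N+1) <= (N+1)(1 - v), and v^(N+1) = 2^(-n/q) no longer depends
   on N. *)
have := @bernoulli_ineq _ (1 - 2 `^ (- ex))%R N.+1.
rewrite subKr -E1 subr_ge0 (ltW v1)/= gerBl v0 => /(_ isT) H.
rewrite ler_pdivlMr ?subr_gt0// mulrC ler_pdivrMr ?subr_gt0//; lra.
Qed.

Lemma frac_integral_strong_bound :
  \int[mu]_(x in E) ((w x)%:E * frac_integral alpha g x) <=
  (strong_const N.+1%:R * K `^ q^-1 * fine (\int[mu]_x (f x `^ p)%:E) `^ p^-1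
   * M `^ (1 - q^-1))%:E.
Proof.
pose phi l x := \int[mu]_(y in box_ball x l) (g y)%:E.
pose J l := \int[mu]_(x in E) ((w x)%:E * phi l x).
have mphi l : measurable_fun setT (phi l).
  apply: measurable_integral_box_ball; first exact/measurable_EFinP.
  by move=> x; rewrite lee_fin.
have phi0 l x : 0 <= phi l x by apply: integral_ge0 => y _; rewrite lee_fin.
have mwE : measurable_fun setT (fun x => (w x)%:E) by exact/measurable_EFinP.
have mwphi l : measurable_fun E (fun x => (w x)%:E * phi l x).
  exact: measurable_funTS (emeasurable_funM mwE (mphi l)).
have wphi0 l x : 0 <= (w x)%:E * phi l x by rewrite mule_ge0// lee_fin.
pose c l := scale_coef n alpha l.
have c0 l : (0 <= c l)%R by exact: powR_ge0.
pose U l x := (c l)%:E * ((w x)%:E * phi l x).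
have mU l : measurable_fun E (U l) by exact: emeasurable_funM.
have U0 l x : 0 <= U l x by rewrite mule_ge0// lee_fin.
pose S k x := U (small_scale r k) x + U (large_scale r k) x.
have mS k : measurable_fun E (S k) by exact: emeasurable_funD (mU _) (mU _).
have S0 k x : 0 <= S k x by exact: adde_ge0.
pose H := (fine (\int[mu]_x (f x `^ p)%:E) `^ p^-1 * M `^ (1 - p^-1))%R.
have H0 : (0 <= H)%R by rewrite mulr_ge0// powR_ge0.
have JE l : (0 < l)%R -> J l <= (2 ^+ n * sconst ((4 * l) ^+ n) * H)%:E.
  by move=> l0; exact: (single_scale p1 q0 qp wW wA A0 uA N0 NA mf f0 fp mE Ey l0).
have UE l : \int[mu]_(x in E) U l x = (c l)%:E * J l.
  by rewrite /U ge0_integralZl_EFin.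
pose B := (2 ^+ n * kernel_const * d `^ alpha * H)%R.
have B0 : (0 <= B)%R by rewrite !mulr_ge0// powR_ge0.
pose z := (2 `^ (- alpha) : R)%R; pose v := (2 `^ (- ex) : R)%R.
have ex0 : (0 < ex)%R by rewrite divr_gt0// mulr_gt0// invr_gt0.
have z01 : (0 <= z < 1)%R by exact: powR_half_lt1.
have v01 : (0 <= v < 1)%R by exact: powR_half_lt1.
have SE k : \int[mu]_(x in E) S k x <= (B * z ^+ k + B * v ^+ k)%:E.
  rewrite /S (ge0_integralD mu mE _ (mU _) _ (mU _))// !UE EFinD.
  have s0 : (0 < small_scale r k)%R by rewrite mulr_gt0// exprn_gt0.
  have t0 : (0 < large_scale r k)%R by rewrite mulr_gt0// exprn_gt0.
  apply: leeD.
    apply: le_trans (lee_wpmul2l _ (JE _ s0)) _; first by rewrite lee_fin.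
    rewrite -EFinM lee_fin.
    have -> : (c (small_scale r k) * (2 ^+ n * sconst ((4 * small_scale r k) ^+ n) * H) =
      2 ^+ n * (scale_coef n alpha (small_scale r k) *
        sconst ((4 * small_scale r k) ^+ n)) * H)%R by rewrite /c; ring.
    by rewrite small_scale_product le_eqVlt; apply/orP; left; apply/eqP; rewrite /B /z; ring.
  apply: le_trans (lee_wpmul2l _ (JE _ t0)) _; first by rewrite lee_fin.
  rewrite -EFinM lee_fin.
  have -> : (c (large_scale r k) * (2 ^+ n * sconst ((4 * large_scale r k) ^+ n) * H) =
      2 ^+ n * (scale_coef n alpha (large_scale r k) *
        sconst ((4 * large_scale r k) ^+ n)) * H)%R by rewrite /c; ring.
  rewrite large_scale_product -/v.
  (* Large scales start at the power k + 1; one factor v <= 1 is dropped to give both series the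
     same shape. *)
  apply: (@le_trans _ _ (B * v ^+ k.+1)%R).
    by rewrite le_eqVlt; apply/orP; left; apply/eqP; rewrite /B; ring.
  rewrite ler_wpM2l// exprS ler_piMl//; last by have /andP[_ /ltW] := v01.
  by rewrite exprn_ge0//; have /andP[] := v01.
apply: (@le_trans _ _ (\int[mu]_(x in E) \sum_(k <oo) S k x)).
  apply: le_ge0_integral => x _.
    rewrite mule_ge0 ?lee_fin//; apply: integral_ge0 => y _.
    by rewrite lee_fin divr_ge0// powR_ge0.
  have SwE k : S k x = (w x)%:E * ((c (small_scale r k))%:E * phi (small_scale r k) x +
      (c (large_scale r k))%:E * phi (large_scale r k) x).
    by rewrite ge0_muleDr ?mule_ge0 ?lee_fin// /S /U !(muleCA (w x)%:E).
  under eq_eseriesr do rewrite SwE.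
  rewrite nneseriesZl; last by move=> k _; rewrite adde_ge0// mule_ge0// lee_fin.
  apply: lee_wpmul2l; first by rewrite lee_fin.
  by apply: frac_integral_le_scales => //; rewrite a0 an.
rewrite (@integral_nneseries _ _ _ mu _ mE S mS (fun k y _ => S0 k y)).
apply: (@le_trans _ _ (B * ((1 - z)^-1 + (1 - v)^-1))%:E).
  apply: nneseries_le_ub => [k|m]; first by apply: integral_ge0 => x _; exact: S0.
  apply: (@le_trans _ _ (\sum_(0 <= k < m) (B * z ^+ k + B * v ^+ k)%:E)).
    by apply: lee_sum => k _; exact: SE.
  rewrite sumEFin lee_fin big_split/= -!mulr_sumr -mulrDr ler_wpM2l//.
  by rewrite lerD// sum_geometric_le.
rewrite lee_fin.
(* Here d^alpha = |E|^(alpha/n) = |E|^(1/p - 1/q). *)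
have dM : (d `^ alpha * M `^ (1 - p^-1) = M `^ (1 - q^-1))%R.
  rewrite -powRrM -PD//; congr (_ `^ _)%R.
  by rewrite mulrC -pq; ring.
apply: (@le_trans _ _ (B * ((1 - z)^-1 + N.+1%:R * (1 - 2 `^ (- (n%:R / q)))^-1))%R).
  by rewrite ler_wpM2l// lerD2l; exact: large_ratio_le.
rewrite -dM /B /H /strong_const /z le_eqVlt; apply/orP; left; apply/eqP; ring.
Qed.

End strong_bound.

(** * Comparison of the two operators *)

Section comparison.
Context (R : realType) (n : nat).
Local Notation T := (Rn R n).
Local Notation mu := (@lebesgue R n).
Local Open Scope ereal_scope.

Lemma lebesgue_set1 (x : T) : (0 < n)%N -> mu [set x] = 0 /\ measurable [set x].
Proof.
move=> n0; have -> : [set x] = cube_of x 0.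
  apply/seteqP; split=> [_ -> i|y xy]; first by rewrite addr0 lexx.
  apply: eq_from_tnth => i; apply/esym/le_anti.
  by have := xy i; rewrite addr0.
split; last exact: measurable_cube_of.
by rewrite lebesgue_cube// expr0n gtn_eqF.
Qed.

Lemma measurable_kernel_section alpha (g : T -> R) x : measurable_fun setT g ->
  measurable_fun setT (fun y => (g y / eucl_dist x y `^ (n%:R - alpha))%:E).
Proof.
move=> mg.
have md : measurable_fun setT (fun y : T => eucl_dist x y : R).
  exact: (measurableT_comp (@measurable_eucl_dist R n) (pair1_measurable x)).
have mk : measurable_fun setT (fun y : T => (eucl_dist x y `^ (n%:R - alpha))^-1 : R)%R.
  rewrite (_ : (fun _ => _) = fun y : T => eucl_dist x y `^ (- (n%:R - alpha)))%R.
    exact: (measurableT_comp (measurable_powR _) md).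
  by apply/funext => y; rewrite powRN.
exact/measurable_EFinP/(measurable_funM mg mk).
Qed.

Lemma abs_frac_integral_le alpha (g : T -> R) x : measurable_fun setT g ->
  `|frac_integral alpha g x| <= frac_integral alpha (fun y => `|g y|)%R x.
Proof.
move=> mg;
apply: le_trans (le_abse_integral mu measurableT (measurable_kernel_section alpha x mg)) _.
rewrite le_eqVlt; apply/orP; left; apply/eqP; apply: eq_integral => y _.
by rewrite /= normrM normfV (ger0_norm (powR_ge0 _ _)).
Qed.

Lemma eucl_dist_cube (a x y : T) l : (0 <= l)%R -> cube_of a l x -> cube_of a l y ->
  (eucl_dist x y <= Num.sqrt n%:R * l)%R.
Proof.
move=> l0 ax ay; rewrite -[leRHS]ger0_norm ?mulr_ge0 ?sqrtr_ge0//.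
rewrite -sqrtr_sqr; apply: ler_wsqrtr.
rewrite exprMn sqr_sqrtr// -[X in (X%:R * _)%R](card_ord n) mulr_natl -sumr_const.
apply: ler_sum => i _; rewrite -subr_ge0 subr_sqr.
have /andP[? ?] := ax i; have /andP[? ?] := ay i.
by apply: mulr_ge0; lra.
Qed.

(** On a cube of side l containing x one has |x - y| <= sqrt(n) l, so the normalising factor
    l^(alpha - n) is at most n^((n - alpha)/2) times the kernel. *)
Lemma cube_average_le alpha (g : T -> R) a l x : (0 < n)%N -> (0 < l)%R ->
  (0 < alpha < n%:R)%R -> measurable_fun setT g -> (forall y, 0 <= g y)%R ->
  cube_of a l x ->
  mu (cube_of a l) `^ (alpha / n%:R) * average (cube_of a l) (fun y => (g y)%:E) <=
  (Num.sqrt n%:R `^ (n%:R - alpha))%:E * frac_integral alpha g x.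
Proof.
move=> n0 l0 /andP[a0 an] mg g0 ax.
have n0' : (0 < n%:R :> R)%R by rewrite ltr0n.
have s0 : (0 < n%:R - alpha)%R by rewrite subr_gt0.
set s := (n%:R - alpha)%R in s0 *.
have c0 : (0 < Num.sqrt n%:R :> R)%R by rewrite sqrtr_gt0.
have cs0 : (0 <= Num.sqrt n%:R `^ s :> R)%R by exact: powR_ge0.
have ls0 : (0 <= l `^ (- s))%R by exact: powR_ge0.
have mQ : measurable (cube_of a l) by exact: measurable_cube_of.
have mk := measurable_kernel_section alpha x mg; rewrite -/s in mk.
have k0 y : 0 <= (g y / eucl_dist x y `^ s)%:E.
  by rewrite lee_fin; exact: divr_ge0 (g0 y) (powR_ge0 _ _).
rewrite averageE// /= lebesgue_cube ?(ltW l0)// muleA.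
have -> : (l ^+ n)%:E `^ (alpha / n%:R) * ((l ^+ n)^-1)%:E = (l `^ (- s))%:E.
  rewrite poweR_EFin -EFinM; congr EFin.
  rewrite -(powR_mulrn n (ltW l0)) -powRN -powRrM.
  rewrite -powRD; last by apply/implyP => _; rewrite gt_eqF.
  by congr (_ `^ _)%R; rewrite /s; field; rewrite gt_eqF.
have mgE : measurable_fun setT (fun y => (g y)%:E) by exact/measurable_EFinP.
apply: (@le_trans _ _ (\int[mu]_(y in cube_of a l)
    ((Num.sqrt n%:R `^ s)%:E * (g y / eucl_dist x y `^ s)%:E))); last first.
  rewrite (ge0_integralZl_EFin mu mQ (fun y _ => k0 y) (measurable_funTS mk) cs0).
  apply: lee_wpmul2l; first by rewrite lee_fin powR_ge0.
  apply: ge0_subset_integral.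
  - exact: mQ.
  - exact: measurableT.
  - exact: mk.
  - by move=> y _; exact: k0.
  - exact: subsetT.
have gE0 y : cube_of a l y -> 0 <= (g y)%:E by rewrite lee_fin.
rewrite -(ge0_integralZl_EFin mu mQ gE0 (measurable_funTS mgE) ls0).
have [x0 mx] := lebesgue_set1 x n0.
apply: ae_ge0_le_integral.
- exact: mQ.
- by move=> y _; rewrite mule_ge0// lee_fin ?powR_ge0.
- exact: measurable_funTS (emeasurable_funM (measurable_cst _) mgE).
- by move=> y _; rewrite mule_ge0// lee_fin powR_ge0.
- exact: measurable_funTS (emeasurable_funM (measurable_cst _) mk).
(* At y = x the kernel has the default value 0 and the comparison may fail; a single point is null
   because n > 0. *)
exists [set x]; split => // y /=; apply: contra_notP => yx ay.
rewrite -!EFinM lee_fin mulrCA mulrC ler_wpM2l//.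
have d0 : (0 < eucl_dist x y)%R.
  rewrite ltNge; apply/negP => d0; apply: yx; apply: eq_from_tnth => i.
  apply/eqP; rewrite -subr_eq0 -normr_le0; apply: le_trans d0.
  by rewrite distrC; exact: coord_le_eucl_dist.
rewrite powRN -ler_pdivrMl ?(powR_gt0 _ c0)//.
rewrite -invfM lef_pV2 ?posrE ?mulr_gt0 ?(powR_gt0 _ c0) ?(powR_gt0 _ l0) ?(powR_gt0 _ d0)//.
rewrite -powRM ?(ltW c0) ?(ltW l0)//.
apply: ge0_ler_powR; rewrite ?nnegrE ?(ltW s0) ?(ltW d0) ?mulr_ge0 ?(ltW c0) ?(ltW l0)//.
exact: eucl_dist_cube (ltW l0) ax ay.
Qed.

Lemma frac_maximal_le alpha (g : T -> R) x : (0 < n)%N ->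
  (0 < alpha < n%:R)%R -> measurable_fun setT g ->
  `|frac_maximal alpha g x| <=
  (Num.sqrt n%:R `^ (n%:R - alpha))%:E * frac_integral alpha (fun y => `|g y|)%R x.
Proof.
move=> n0 an mg; rewrite gee0_abs.
  apply: ge_ereal_sup => _ [_ [[a [l [l0 ->]]] ax] <-].
  have mga : measurable_fun setT (fun y => `|g y|)%R.
    exact: (measurableT_comp (@normr_measurable R setT) mg).
  exact: (cube_average_le n0 l0 an mga (fun y => normr_ge0 _) ax).
have x1 : cube_of x 1%R x by move=> i; rewrite lexx lerDl ler01.
apply: le_trans (ereal_sup_ubound _); last first.
  by exists (cube_of x 1%R) => //; split => //; exists x, 1%R.
rewrite averageE// mule_ge0 ?poweR_ge0// mule_ge0 ?lee_fin ?invr_ge0 ?exprn_ge0//.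
by apply: integral_ge0 => y _; rewrite lee_fin.
Qed.

End comparison.

Section Ainfty_ge1.
Context (R : realType) (n : nat).
Local Notation T := (Rn R n).
Local Notation mu := (@lebesgue R n).
Local Open Scope ereal_scope.

(** Testing the maximal function with Q itself bounds it below on Q by the average of w^q; for the
    unit cube that average equals the integral. The bound A >= 1 later absorbs additive
    constants. *)
Lemma Ainfty_char_ge1 (p q : R) (w : T -> R) : weight w -> Apq p q w ->
  1 <= Ainfty_char (fun x => w x `^ q)%R.
Proof.
move=> wW wA; set u := (fun x => _).
have u0 x : (0 <= u x)%R by exact: powR_ge0.
pose Q : set T := cube_of point 1%R.
have mQ : measurable Q by exact: measurable_cube_of.
have I0 : 0 < \int[mu]_(x in Q) (u x)%:E by exact: weight_cube_gt0.
have Iy : \int[mu]_(x in Q) (u x)%:E < +oo by exact: (weight_cube_lty wW wA).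
apply: (@le_trans _ _ ((\int[mu]_(x in Q) (u x)%:E)^-1 *
   \int[mu]_(x in Q) HL_max (fun y => u y * \1_Q y)%R x)); last first.
  by apply: ereal_sup_ubound; exists Q => //; exists point, 1%R.
have finI : \int[mu]_(x in Q) (u x)%:E \is a fin_num by rewrite ge0_fin_numE// ltW.
have H : \int[mu]_(x in Q) (u x)%:E <= \int[mu]_(x in Q) HL_max (fun y => u y * \1_Q y)%R x.
  have <- : \int[mu]_(x in Q) cst (\int[mu]_(y in Q) (u y)%:E) x = \int[mu]_(x in Q) (u x)%:E.
    by rewrite integral_cst// /= lebesgue_cube// expr1n mule1.
  apply: le_ge0_integral => x Qx /=; first exact: ltW.
  have := @le_HL_max _ _ (fun y => u y * \1_Q y)%R point 1%R x ltr01 Qx.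
  apply: le_trans; rewrite averageE// expr1n invr1 mul1e.
  rewrite le_eqVlt; apply/orP; left; apply/eqP; apply: eq_integral => y yQ.
  by rewrite indicE yQ mulr1 ger0_norm.
move: I0 H; rewrite -(fineK finI) lte_fin => I0 H.
by rewrite inver gt_eqF// lee_pdivlMl// mule1.
Qed.

End Ainfty_ge1.

(** * The weak-type inequality *)

Section weak_bound.
Context (R : realType) (n : nat).
Local Notation T := (Rn R n).
Local Notation mu := (@lebesgue R n).
Variables (alpha p q A : R) (N : nat) (w f : T -> R).
Hypotheses (a0 : 0 < alpha) (an : alpha < n%:R).
Hypotheses (p1 : 1 <= p) (q0 : 0 < q) (pq : p^-1 - q^-1 = alpha / n%:R).
Hypotheses (wW : weight w) (wA : Apq p q w).
Hypotheses (A0 : 0 <= A) (uA : (Ainfty_char (fun x => w x `^ q)%R <= A%:E)%E).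
Hypotheses (N0 : (0 < N)%N) (NA : 2 ^+ n.+2 * A <= N%:R).
Hypotheses (mf : measurable_fun setT f) (f0 : forall x, 0 <= f x).
Hypothesis fp : (\int[mu]_x (f x `^ p)%:E < +oo)%E.
Local Notation K := (fine (Apq_char p q w)).
Local Open Scope ereal_scope.
Let g y := ((w y)^-1 * f y)%R.
Let mw : measurable_fun setT w. Proof. by have [] := wW. Qed.
Let w0 x : (0 <= w x)%R. Proof. by have [] := wW. Qed.
Let mg : measurable_fun setT g.
Proof. exact: measurable_funM (measurable_fun_inv_ge0 mw w0) mf. Qed.
Let g0 y : (0 <= g y)%R. Proof. by rewrite mulr_ge0// invr_ge0. Qed.
Let I := frac_integral alpha g.
Let mI : measurable_fun setT I. Proof. exact: measurable_frac_integral. Qed.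
Let I0 x : 0 <= I x.
Proof. by apply: integral_ge0 => y _; rewrite lee_fin divr_ge0// powR_ge0. Qed.

Lemma bigcup_box_ball (z : T) : \bigcup_m box_ball z m%:R = setT.
Proof.
apply/seteqP; split=> // x _; exists (Num.truncn (eucl_dist x z)).+1 => //.
apply/box_ballP => i; apply: le_trans (coord_le_eucl_dist x z i) _.
exact/ltW/truncnS_gt.
Qed.

Local Notation B := (strong_const n alpha q N.+1%:R * K `^ q^-1 *
  fine (\int[mu]_x (f x `^ p)%:E) `^ p^-1)%R.

(** On a part E of the level set, lambda |E| <= B |E|^(1 - 1/q). Dividing requires 0 < |E| < +oo,
    hence the intersection with boxes, which then exhaust the space. *)
Lemma frac_integral_weak_bound lambda : (0 < lambda)%R ->
  mu [set x | lambda%:E < (w x)%:E * I x] <= ((B / lambda) `^ q)%:E.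
Proof.
move=> l0; set S := [set x | _].
have mwI : measurable_fun setT (fun x => (w x)%:E * I x).
  have mwE : measurable_fun setT (fun x => (w x)%:E) by exact/measurable_EFinP.
  exact: emeasurable_funM mwE mI.
have mS : measurable S.
  rewrite -[S]setTI; exact: (emeasurable_fun_o_infty measurableT mwI).
pose z : T := point; pose Em m := S `&` box_ball z m%:R.
have mE m : measurable (Em m) by apply: measurableI => //; exact: measurable_box_ball.
have bound m : mu (Em m) <= ((B / lambda) `^ q)%:E.
  have [->|E0] := eqVneq (mu (Em m)) 0; first by rewrite lee_fin powR_ge0.
  have Ey : mu (Em m) < +oo.
    apply: (@le_lt_trans _ _ (mu (box_ball z m%:R))).
      by apply: le_lebesgue; exact: subIsetr.
    by rewrite lebesgue_box_ball// ltry.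
  have E0' : 0 < mu (Em m) by rewrite lt0e E0 measure_ge0.
  have finE : mu (Em m) \is a fin_num by rewrite ge0_fin_numE.
  have := frac_integral_strong_bound a0 an p1 q0 pq wW wA A0 uA N0 NA mf f0 fp (mE m) E0' Ey.
  set M := fine (mu (Em m)) => H.
  have M0 : (0 < M)%R by rewrite fine_gt0// E0'.
  have ME : mu (Em m) = M%:E by rewrite /M fineK.
  have {}H : (lambda * M <= B * M `^ (1 - q^-1))%R.
    rewrite -lee_fin EFinM -ME; apply: le_trans H.
    rewrite -integral_cst; last exact: mE.
    by apply: le_ge0_integral => x [/ltW Sx _] //; rewrite lee_fin ltW.
  rewrite ME lee_fin.
  have ME2 : M = (M `^ (1 - q^-1) * M `^ q^-1)%R.
    by rewrite -powRD ?subrK ?powRr1 ?(ltW M0)//; apply/implyP => _; rewrite gt_eqF.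
  have H2 : (M `^ q^-1 <= B / lambda)%R.
    rewrite ler_pdivlMr// -(ler_pM2l (powR_gt0 (1 - q^-1) M0)).
    by rewrite mulrA -ME2 mulrC [leRHS]mulrC.
  have -> : M = ((M `^ q^-1) `^ q)%R by rewrite -powRrM mulVf ?powRr1 ?gt_eqF// ltW.
  apply: ge0_ler_powR; rewrite ?nnegrE ?(ltW q0) ?powR_ge0//.
  by apply: le_trans H2; exact: powR_ge0.
have SE : \bigcup_m Em m = S.
  by rewrite /Em -setI_bigcupr bigcup_box_ball setIT.
have ndE : nondecreasing_seq Em.
  move=> i j ij; apply/subsetPset => x [Sx xi]; split => //.
  by apply: le_box_ball xi; rewrite ler_nat.
have mSE : measurable (\bigcup_m Em m) by rewrite SE.
have cE := @nondecreasing_cvg_mu _ _ _ mu Em mE mSE ndE.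
rewrite -SE -(cvg_lim (@ereal_hausdorff R) cE); apply: lime_le; first exact: cvgP cE.
by apply: nearW => m; exact: bound.
Qed.

Lemma frac_integral_eq0 x : \int[mu]_x (f x `^ p)%:E = 0 -> I x = 0.
Proof.
move=> fp0.
have mfp : measurable_fun setT (fun x => (f x `^ p)%:E).
  by apply/measurable_EFinP; exact: (measurableT_comp (measurable_powR p) mf).
have p0 : (0 < p)%R by exact: lt_le_trans p1.
have fae : ae_eq mu setT (fun x => (f x `^ p)%:E) (cst 0).
  apply/(ae_eq_integral_abs mu measurableT mfp); rewrite -[RHS]fp0.
  by apply: eq_integral => y _ /=; rewrite ger0_norm// powR_ge0.
have mk := measurable_kernel_section alpha x mg.
rewrite /I /frac_integral (ae_eq_integral (cst 0)) ?integral0//.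
move: fae; apply: filterS => y /(_ Logic.I) /= [] /powR_eq0_eq0 fy _.
by rewrite /g fy mulr0 mul0r.
Qed.

End weak_bound.

(** * Assembling the constant *)

Section strong_const_order.
Context (R : realType) (n : nat) (alpha q : R).
Hypotheses (a0 : 0 < alpha) (nq : 0 < n%:R / q).

Let zi : 0 < (1 - 2 `^ (- alpha))^-1 :> R.
Proof. by have /andP[_ ?] := powR_half_lt1 a0; rewrite invr_gt0 subr_gt0. Qed.

Let vi : 0 < (1 - 2 `^ (- (n%:R / q)))^-1 :> R.
Proof. by have /andP[_ ?] := powR_half_lt1 nq; rewrite invr_gt0 subr_gt0. Qed.

Lemma strong_const_gt0 B : 0 <= B -> 0 < strong_const n alpha q B.
Proof.
move=> B0; apply: mulr_gt0; first by rewrite !mulr_gt0 ?powR_gt0 ?exprn_gt0.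
by rewrite ltr_wpDr// mulr_ge0// ltW.
Qed.

(** The small-scale term carries no A; A >= 1 lets it be multiplied by A too. *)
Lemma strong_const_le B D A : 1 <= A -> B <= D * A ->
  strong_const n alpha q B <= strong_const n alpha q D * A.
Proof.
move=> A1 BDA; rewrite /strong_const -[leRHS]mulrA.
apply: ler_wpM2l; first by rewrite !mulr_ge0 ?powR_ge0.
by rewrite mulrDl lerD ?ler_peMr ?(ltW zi)// mulrAC ler_wpM2r ?(ltW vi).
Qed.

End strong_const_order.

Theorem theorem1p8 (R : realType) (n : nat) (alpha p q : R)
    (alpha_gt0 : 0 < alpha) (alpha_ltn : alpha < n%:R)
    (p_ge1 : 1 <= p) (p_lt : p < n%:R / alpha)
    (pq : p^-1 - q^-1 = alpha / n%:R) :
  exists C : R, forall (w f : Rn R n -> R) (lambda : R),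
    weight w -> Apq p q w -> f \in Lfun lebesgue p%:E -> 0 < lambda ->
    let rhs := (C%:E * Apq_char p q w
                * Ainfty_char (fun x => w x `^ q)%R `^ q
                * ((lambda `^ q)^-1)%:E
                * (\int[lebesgue]_x (`|f x| `^ p)%:E) `^ (q / p))%E in
    (lebesgue [set x | lambda%:E <
       `|(w x)%:E * frac_integral alpha (fun y => (w y)^-1 * f y)%R x|]
       <= rhs)%E /\
    (lebesgue [set x | lambda%:E <
       `|(w x)%:E * frac_maximal alpha (fun y => (w y)^-1 * f y)%R x|]
       <= rhs)%E.
Proof.
have nR0 : 0 < n%:R :> R by exact: lt_trans alpha_ltn.
have n0 : (0 < n)%N by move: nR0; rewrite ltr0n.
have p0 : 0 < p by exact: lt_le_trans p_ge1.
have q0 : 0 < q.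
  rewrite -invr_gt0; have -> : q^-1 = p^-1 - alpha / n%:R by rewrite -pq; ring.
  by rewrite subr_gt0 -[alpha / _]invrK invf_div ltf_pV2 ?posrE ?divr_gt0.
have nq0 : 0 < n%:R / q by rewrite divr_gt0.
(* With N the integer part of 2^(n+2) A plus one, N + 1 <= 2^(n+2) A + 2 <= D A because A >= 1. *)
pose D : R := 2 ^+ n.+2 + 2; have D0 : 0 <= D by rewrite addr_ge0// exprn_ge0.
pose C1 := strong_const n alpha q D.
pose C2 : R := Num.sqrt n%:R `^ (n%:R - alpha).
have C1_gt0 : 0 < C1 by exact: strong_const_gt0.
have C2_gt0 : 0 < C2 by rewrite powR_gt0// sqrtr_gt0.
have C2_ge1 : 1 <= C2.
  apply: (@le_trans _ _ (1 `^ (n%:R - alpha))); first by rewrite powR1.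
  apply: ge0_ler_powR; rewrite ?nnegrE ?subr_ge0 ?(ltW alpha_ltn) ?sqrtr_ge0//.
  by rewrite -[leLHS]sqrtr1 ler_wsqrtr// ler1n.
exists ((C1 * C2) `^ q) => w f lambda wW wA fL l0.
have C0 : 0 < (C1 * C2) `^ q by rewrite powR_gt0// mulr_gt0.
set Fp := (\int[lebesgue]_x (`|f x| `^ p)%:E)%E; set Ai := Ainfty_char _.
move=> rhs.
have mf : measurable_fun setT f by move: fL; rewrite inE => /andP[/[!inE]].
have mfa : measurable_fun setT (fun x => `|f x|).
  exact: (measurableT_comp (@normr_measurable R setT) mf).
have Fpy : (Fp < +oo)%E.
  have /integrableP[_] := Lfun_integrable p_ge1 fL.
  by under eq_integral do rewrite gee0_abs ?lee_fin ?powR_ge0//.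
have Fp0 : (0 <= Fp)%E by apply: integral_ge0 => x _; rewrite lee_fin powR_ge0.
have w0 x : 0 <= w x by have [] := wW.
have mw : measurable_fun setT w by have [] := wW.
have mg := measurable_funM (measurable_fun_inv_ge0 mw w0) mf.
pose Ib := frac_integral alpha (fun y => (w y)^-1 * `|f y|).
have absg : (fun y => `|(w y)^-1 * f y|) = (fun y => (w y)^-1 * `|f y|).
  by apply/funext => y; rewrite normrM ger0_norm// invr_ge0.
have K0 : (0 < Apq_char p q w)%E by exact: Apq_char_gt0.
have Ai1 : (1 <= Ai)%E by exact: Ainfty_char_ge1 wW wA.
have lq0 : 0 < (lambda `^ q)^-1 by rewrite invr_gt0 powR_gt0.
have an : 0 < alpha < n%:R by rewrite alpha_gt0.
(* One level set serves both operators: [frac_maximal] is at most C2 times the integral [Ib], and C2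
   >= 1 makes the lower level lambda/C2 harmless for [frac_integral]. *)
suff main : (lebesgue [set x | (lambda / C2)%:E < (w x)%:E * Ib x] <= rhs)%E.
  split; apply: le_trans main; apply: le_lebesgue => x /=.
    move=> /lt_le_trans lx; apply: (@le_lt_trans _ _ lambda%:E).
      by rewrite lee_fin ler_piMr ?(ltW l0)// invf_le1.
    apply: lx; rewrite abseM gee0_abs ?lee_fin//; apply: lee_wpmul2l; first by rewrite lee_fin.
    by rewrite /Ib -absg; exact: abs_frac_integral_le.
  rewrite abseM gee0_abs ?lee_fin// => lx.
  rewrite mulrC EFinM -lte_pdivlMl ?invr_gt0// invrK.
  apply: lt_le_trans lx _; rewrite muleCA; apply: lee_wpmul2l; first by rewrite lee_fin.
  by rewrite /Ib -absg; exact: frac_maximal_le.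
(* This case precedes that of an infinite characteristic: 0 times +oo is 0, so the right-hand side
   vanishes when f = 0 almost everywhere, and the level set must be empty. *)
have [Fp_0|Fp_neq0] := eqVneq Fp 0%E.
  rewrite (_ : [set x | _] = set0) ?measure0.
    by rewrite !mule_ge0 ?poweR_ge0 ?lee_fin ?(ltW C0) ?(ltW K0) ?(ltW lq0).
  apply/seteqP; split=> // x /=.
  rewrite /Ib (frac_integral_eq0 _ p_ge1 wW mfa _ Fp_0) mule0 lte_fin ltNge.
  by rewrite divr_ge0// ltW.
have Fp_gt0 : (0 < Fp)%E by rewrite lt0e Fp_neq0.
have [Aiy|Aiy] := eqVneq Ai +oo%E.
  rewrite /rhs Aiy poweRyr ?gt_eqF// gt0_muley; last by rewrite mule_gt0// lte_fin.
  by rewrite gt0_mulye ?lte_fin// gt0_mulye ?poweR_gt0// leey.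
have finA : Ai \is a fin_num.
  by rewrite ge0_fin_numE ?ltey// (le_trans _ Ai1).
pose A := fine Ai; have AE : Ai = A%:E by rewrite /A fineK.
have A1 : 1 <= A by rewrite -lee_fin -AE.
have A0 : 0 <= A by exact: le_trans A1.
pose N := (Num.truncn (2 ^+ n.+2 * A)).+1.
have NA : 2 ^+ n.+2 * A <= N%:R by exact/ltW/truncnS_gt.
have ND : N.+1%:R <= D * A.
  have X0 : 0 <= 2 ^+ n.+2 * A by rewrite mulr_ge0// exprn_ge0.
  have := truncn_le (2 ^+ n.+2 * A); rewrite X0 /N /D -!natr1 mulrDl; lra.
have uA : (Ainfty_char (fun x => w x `^ q)%R <= A%:E)%E by rewrite -AE.
have lC0 : 0 < lambda / C2 by rewrite divr_gt0.
have := frac_integral_weak_bound alpha_gt0 alpha_ltn p_ge1 q0 pq wW wA A0 uA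
  (ltn0Sn _) NA mfa (fun x => normr_ge0 _) Fpy lC0.
move=> /le_trans; apply.
have finK : Apq_char p q w \is a fin_num by rewrite ge0_fin_numE// ltW.
have finF : Fp \is a fin_num by rewrite ge0_fin_numE.
rewrite /rhs AE -(fineK finK) -(fineK finF) !poweR_EFin -!EFinM lee_fin.
set K := fine (Apq_char p q w); set F := fine Fp.
have K_ge0 : 0 <= K by rewrite fine_ge0// ltW.
have F_ge0 : 0 <= F by rewrite fine_ge0.
have sN := strong_const_le alpha_gt0 nq0 A1 ND; rewrite -/C1 in sN.
clearbody C1 C2.
have KF0 : 0 <= K `^ q^-1 * F `^ p^-1 by rewrite mulr_ge0// powR_ge0.
have Kq : (K `^ q^-1) `^ q = K by rewrite -powRrM mulVf ?powRr1 ?gt_eqF.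
have Fq : (F `^ p^-1) `^ q = F `^ (q / p) by rewrite -powRrM mulrC.
have C12 : 0 <= C1 * C2 by rewrite mulr_ge0// ltW.
(* Inside the outer q-th power A is linear and K has exponent 1/q, which yields exactly A^q and
   K. *)
apply: (@le_trans _ _ ((C1 * C2 * (K `^ q^-1) * A * lambda^-1 * F `^ p^-1) `^ q)).
  apply: ge0_ler_powR; rewrite ?nnegrE ?(ltW q0)//.
  - rewrite divr_ge0 ?(ltW lC0)// -mulrA mulr_ge0//.
    by apply/ltW/strong_const_gt0.
  - by rewrite !mulr_ge0 ?powR_ge0 ?invr_ge0 ?(ltW l0) ?(ltW C1_gt0) ?(ltW C2_gt0).
  have -> : C1 * C2 * K `^ q^-1 * A * lambda^-1 * F `^ p^-1 =
      C1 * A * (K `^ q^-1 * F `^ p^-1) / (lambda / C2).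
    by rewrite invf_div; ring.
  by rewrite ler_wpM2r ?invr_ge0 ?(ltW lC0)// -mulrA ler_wpM2r.
rewrite !powRM ?mulr_ge0 ?invr_ge0 ?powR_ge0 ?(ltW l0) ?(ltW C1_gt0) ?(ltW C2_gt0)//.
rewrite Kq Fq.
by rewrite -[lambda^-1](powR_inv1 (ltW l0)) -powRrM mulN1r powRN.
Qed.
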